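(* Let $K$ be an algebraically closed field, let $n\geq 2$ be an integer and set $N=2n-1$. Let $d,a_1,\dots,a_{n-1}$ be positive integers, and suppose that $d$ is divisible by two distinct primes $p$ and $q$. Let $V\subset K^N$ be the affine toric variety (of codimension $n-1$), in the coordinates $x_1,\dots,x_n,y_1,\dots,y_{n-1}$ of $K^N$, given by the parametrization $$x_i=u_i\ (1\le i\le n-1),\qquad x_n=u_n^d,\qquad y_i=u_i^{a_i}u_n\ (1\le i\le n-1),$$ where $(u_1,\dots,u_n)$ ranges over $K^n$. Then $\operatorname{ara} V\geq N-2$.
   Context: The arithmetical rank $\operatorname{ara} V$ of an affine variety $V\subset K^N$ is the minimum number of equations needed to define it set-theoretically, i.e. the least $s$ for which there exist polynomials $F_1,\dots,F_s$ over $K$ in the $N$ coordinates of $K^N$ such that $V$ is exactly the set of common zeros of $F_1,\dots,F_s$ in $K^N$. The variety $V$ is the image of the map $K^n\to K^N$, $(u_1,\dots,u_n)\mapsto(u_1,\dots,u_{n-1},u_n^d,u_1^{a_1}u_n,\dots,u_{n-1}^{a_{n-1}}u_n)$. No assumption is made on the characteristic of $K$. *)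

(* Defs.v *)
From mathcomp Require Import all_boot all_order all_algebra.
From mathcomp Require Import mpoly.

Set Implicit Arguments.
Unset Strict Implicit.
Unset Printing Implicit Defensive.

Import GRing.Theory.
Local Open Scope ring_scope.

Section ArithmeticalRank.

Variables (K : fieldType) (N : nat).

(* The point v of K^N is the row vector v, and [v 0] is its coordinate function
   'I_N -> K. For s = 0 the common zero set is K^N. *)
Definition defined_by_equations (V : 'rV[K]_N -> Prop) (s : nat) : Prop :=
  exists F : 'I_s -> {mpoly K[N]},
    forall v : 'rV[K]_N, V v <-> forall i : 'I_s, (F i).@[v 0] = 0.

(* A relation rather than a function, since V ranges over arbitrary subsets
   of K^N; the value r, when it exists, is unique. *)
Definition is_arithmetical_rank (V : 'rV[K]_N -> Prop) (r : nat) : Prop :=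
  defined_by_equations V r /\
  forall s : nat, defined_by_equations V s -> (r <= s)%N.

End ArithmeticalRank.

Section ToricVariety.

Lemma ambient_dimE (n : nat) : (2 * n - 1 = n + n.-1)%N.
Proof. by case: n => [|n] //; rewrite mul2n -addnn addnS subn1 addSn. Qed.

Lemma last_index_subproof (n : nat) : (2 <= n -> n.-1 < n)%N.
Proof. by case: n. Qed.

(* Indices are shifted by one: u_1, ..., u_n are the coordinates 0, ..., n.-1. *)
Definition last_index (n : nat) (hn : (2 <= n)%N) : 'I_n :=
  Ordinal (last_index_subproof hn).

Definition init_index (n : nat) (j : 'I_n.-1) : 'I_n :=
  widen_ord (leq_pred n) j.

(* The first n coordinates of K^(2n-1) are x_1, ..., x_n, the remaining n.-1
   ones are y_1, ..., y_(n-1). *)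
Definition toric_map (K : fieldType) (n : nat) (hn : (2 <= n)%N) (d : nat)
    (a : 'I_n.-1 -> nat) (u : 'rV[K]_n) : 'rV[K]_(2 * n - 1) :=
  \row_(k < 2 * n - 1)
    match split (cast_ord (ambient_dimE n) k) with
    | inl i => if i == last_index hn then u 0 i ^+ d else u 0 i
    | inr j => u 0 (init_index j) ^+ a j * u 0 (last_index hn)
    end.

Definition toric_variety (K : fieldType) (n : nat) (hn : (2 <= n)%N) (d : nat)
    (a : 'I_n.-1 -> nat) (v : 'rV[K]_(2 * n - 1)) : Prop :=
  exists u : 'rV[K]_n, v = toric_map hn d a u.

End ToricVariety.

(* Main.v *)
Require Import Defs.
From HB Require Import structures.
From Stdlib Require Import Classical_Prop.
From mathcomp Require Import all_boot all_order all_algebra.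
From mathcomp Require Import fraction mpoly ring.

Set Implicit Arguments.
Unset Strict Implicit.
Unset Printing Implicit Defensive.

Import GRing.Theory.

(** Why the bound holds.

    Cut [V] by the hyperplane [x_n = 1] and write [m = n - 1].  What is left in
    [K^(2m)] is the union, over the roots [z] of [z ^ d = 1], of the graphs
    [y_j = z x_j ^ a_j].  Two different graphs meet at the origin only, and
    there are at least two of them: [d] has two prime divisors, one of which is
    invertible in [K] and so provides a root of unity other than 1.  Any system
    of equations for [V] restricts to one for this union, so it is enough to see
    that the union is not the zero set of [2m - 2] polynomials
    ([graph_union_size]).

    This is an instance of the fact that a set which falls apart when a point is
    removed from it needs many equations, and the argument is the usual one with
    the cohomology of the structure sheaf.  Let [X1] be one of the graphs, [X2]
    the union of the others, and [U1], [U2] their complements.  Then [U1] and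
    [U2] cover the punctured space, whose cohomology in degree [2m - 1] is not
    zero, while [U1] and [U2] intersect in the complement of the union, whose
    cohomology vanishes from degree [s] on when [s] equations suffice.  If
    [s <= 2m - 2], the Mayer-Vietoris sequence makes the top class of the
    punctured space vanish as soon as its restrictions to [U1] and to [U2] do.
    They do, because the class can be written with [m] equations of [X1] and [m]
    equations of one graph contained in [X2], and it needs all [2m] of them.

    Everything is done with explicit Cech cochains.  A cochain is a function from
    sequences of letters to the field of fractions, each letter standing for a
    nonzero polynomial, hence for a principal open set; a value is regular when
    its denominator is a power of the product of the letters.  All sequences are
    allowed, the empty one and those with repetitions included, which turns
    homotopies into the operation of adding a letter in front.  One exactness
    statement, [exact_relative], gives every vanishing that is needed; the open
    covers are compared through radicals of ideals, which Hilbert's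
    Nullstellensatz computes ([nullstellensatz]).  [mayer_vietoris] is the
    sequence above.  The class is [koszul], a product of operators built from
    partitions of unity.  On the coordinate functions it is a nonzero constant
    over the monomial [prod_j x_j ^ a_j y_j], and no such fraction is a sum of
    fractions each of whose denominators omits a variable
    ([coboundary_residue]).

    The arithmetical rank exists because the equations
    [y_j ^ d = x_j ^ (a_j d) x_n] and [y_j x_k ^ a_k = y_k x_j ^ a_j] define
    [V]. *)

(** * Radicals and Hilbert's Nullstellensatz *)

Section Ideals.
Local Open Scope ring_scope.
Variable A : comNzRingType.
Implicit Types (J : A -> Prop) (s : seq A) (a b : A).

Record is_ideal J : Prop := IsIdeal {
  ideal0 : J 0;
  idealD : forall a b, J a -> J b -> J (a + b);
  idealM : forall a b, J b -> J (a * b) }.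

(** The ideal spanned by [s], through its universal property: a fact about its
    elements is then proved by exhibiting an ideal that contains [s]. *)
Definition generated s a : Prop :=
  forall J, is_ideal J -> (forall p, p \in s -> J p) -> J a.

Definition radical s a : Prop := exists r, generated s (a ^+ r).

Lemma idealN J a : is_ideal J -> J a -> J (- a).
Proof. by move=> idJ Ja; rewrite -mulN1r; apply: idealM. Qed.

Lemma ideal_sum J (I : Type) (r : seq I) (P : pred I) (F : I -> A) :
  is_ideal J -> (forall i, P i -> J (F i)) -> J (\sum_(i <- r | P i) F i).
Proof.
move=> idJ JF; apply: (big_ind J) => //; first exact: ideal0.
by move=> a b; apply: idealD.
Qed.

Lemma ideal_binomial J a b m n :
  is_ideal J -> J (a ^+ m) -> J (b ^+ n) -> J ((a + b) ^+ (m + n)).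
Proof.
move=> idJ Ja Jb; rewrite exprDn.
apply: ideal_sum => // i _; rewrite -mulr_natl; apply: (idealM idJ).
have [le_ni|lt_in] := leqP n i.
  by rewrite -(subnK le_ni) exprD mulrA; apply: (idealM idJ).
have -> : (m + n - i = n - i + m)%N by rewrite [RHS]addnC addnBA // ltnW.
by rewrite exprD mulrC mulrA; apply: (idealM idJ).
Qed.

Lemma generated_ideal s : is_ideal (generated s).
Proof.
split=> [J idJ _|a b ha hb J idJ sJ|a b hb J idJ sJ]; first exact: ideal0.
- by apply: idealD; [|apply: ha|apply: hb].
- by apply: idealM => //; apply: hb.
Qed.

Lemma mem_generated s p : p \in s -> generated s p.
Proof. by move=> sp J _; apply. Qed.

Lemma radical_ideal s : is_ideal (radical s).
Proof.
have gi := generated_ideal s.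
split.
- by exists 1%N; rewrite expr1; apply: (ideal0 gi).
- by move=> a b [m ha] [n hb]; exists (m + n)%N; apply: (ideal_binomial gi).
- by move=> a b [n hb]; exists n; rewrite exprMn; apply: (idealM gi).
Qed.

Lemma generated_radical s a : generated s a -> radical s a.
Proof. by move=> ga; exists 1%N; rewrite expr1. Qed.

Lemma mem_radical s p : p \in s -> radical s p.
Proof. by move=> sp; apply: generated_radical; apply: mem_generated. Qed.

Lemma radicalX s a n : radical s (a ^+ n) -> radical s a.
Proof. by case=> r ga; exists (n * r)%N; rewrite exprM. Qed.

Lemma radical_trans s s' a :
  (forall p, p \in s -> radical s' p) -> radical s a -> radical s' a.
Proof.
by move=> ss' [r ga]; apply: (@radicalX _ _ r); apply: ga ss'; apply: radical_ideal.
Qed.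

(** Membership in the radical may be tested on the two pieces [a <> 0] and
    [a = 0]: the multipliers of [b] into the radical form an ideal. *)
Lemma radical_split s a b :
  radical s (a * b) -> radical (a :: s) b -> radical s b.
Proof.
move=> hab [r hb]; apply: (@radicalX _ _ r.+1); rewrite exprSr.
have ri := radical_ideal s.
apply: (hb (fun c => radical s (c * b))).
  split=> [|c c' hc hc'|c c' hc]; first by rewrite mul0r; apply: (ideal0 ri).
  - by rewrite mulrDl; apply: (idealD ri).
  - by rewrite -mulrA; apply: (idealM ri).
move=> p; rewrite inE => /predU1P[->//|sp].
by rewrite mulrC; apply: (idealM ri) => //; apply: mem_radical.
Qed.

(** By the binomial formula, the elements having a power in an ideal form an
    ideal. *)
Lemma radical_in s a J :
  is_ideal J -> (forall p, p \in s -> exists t, J (p ^+ t)) -> radical s a ->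
  exists t, J (a ^+ t).
Proof.
move=> idJ sJ [r ga].
have [t Jt] : exists t, J ((a ^+ r) ^+ t); last by exists (r * t)%N; rewrite exprM.
apply: (ga (fun b => exists t, J (b ^+ t))) => //; split.
- by exists 1%N; rewrite expr1; apply: ideal0.
- by move=> b c [m hb] [n hc]; exists (m + n)%N; apply: (ideal_binomial idJ).
- by move=> b c [n hc]; exists n; rewrite exprMn; apply: idealM.
Qed.

Lemma generated_lincomb (I : finType) (f : I -> A) a :
  generated [seq f i | i <- enum I] a -> exists u : I -> A, a = \sum_i u i * f i.
Proof.
move=> ga; apply: (ga (fun b => exists u : I -> A, b = \sum_i u i * f i)).
  split.
  - by exists (fun=> 0); rewrite big1 // => i _; rewrite mul0r.
  - move=> b c [u ->] [v ->]; exists (fun i => u i + v i).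
    by rewrite -big_split; apply: eq_bigr => i _; rewrite mulrDl.
  - move=> b c [u ->]; exists (fun i => b * u i).
    by rewrite mulr_sumr; apply: eq_bigr => i _; rewrite mulrA.
move=> p /mapP[i _ ->]; exists (fun j => (j == i)%:R).
rewrite (bigD1 i) //= eqxx mul1r big1 ?addr0 // => j /negPf->.
by rewrite mul0r.
Qed.

End Ideals.

Section NullstellensatzStep.
Local Open Scope ring_scope.

Lemma radical_morph (A B : comNzRingType) (f : {rmorphism A -> B}) s a :
  radical s a -> radical [seq f x | x <- s] (f a).
Proof.
case=> r ga; exists r; rewrite -rmorphXn.
apply: (ga (fun b => generated _ (f b))); last first.
  by move=> p sp; exact: (mem_generated (map_f f sp)).
have gi := generated_ideal [seq f x | x <- s].
split=> [|b c hb hc|b c hc]; first by rewrite rmorph0; apply: (ideal0 gi).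
- by rewrite rmorphD; apply: (idealD gi).
- by rewrite rmorphM; apply: (idealM gi).
Qed.

Variables (K : closedFieldType) (A : comNzRingType) (X : Type).
Variable ev : X -> {rmorphism A -> K}.

Definition evp (x : X) (t : K) (p : {poly A}) : K := (map_poly (ev x) p).[t].

Hypothesis nullA : forall (s : seq A) (R : A),
  (forall x, (forall p, p \in s -> ev x p = 0) -> ev x R = 0) -> radical s R.

Let evp0 x t : evp x t 0 = 0. Proof. by rewrite /evp rmorph0 horner0. Qed.
Let evpB x t p q : evp x t (p - q) = evp x t p - evp x t q.
Proof. by rewrite /evp rmorphB hornerD hornerN. Qed.
Let evpM x t p q : evp x t (p * q) = evp x t p * evp x t q.
Proof. by rewrite /evp rmorphM hornerM. Qed.
Let evpC x t a : evp x t a%:P = ev x a.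
Proof. by rewrite /evp map_polyC hornerC. Qed.
Let evpZ x t a p : evp x t (a *: p) = ev x a * evp x t p.
Proof. by rewrite -mul_polyC evpM evpC. Qed.

Definition vanishes_on (s : seq {poly A}) (R : {poly A}) : Prop :=
  forall x t, (forall p, p \in s -> evp x t p = 0) -> evp x t R = 0.

Lemma radical_coefs (s : seq {poly A}) (R : {poly A}) :
  (forall i, radical s (R`_i)%:P) -> radical s R.
Proof.
move=> hR; rewrite -[R]coefK poly_def.
have ri := radical_ideal s; apply: (ideal_sum _ ri) => i _.
by rewrite -mul_polyC mulrC; apply: (idealM ri).
Qed.

Lemma poly_infinite (p : {poly K}) : (forall t, p.[t] = 0) -> p = 0.
Proof.
move=> p0; apply/eqP/negPn/negP => /closed_nonrootP[t].
by rewrite /root p0 eqxx.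
Qed.

(** Without equations involving the variable, a polynomial in it vanishes for
    all its values only if its coefficients vanish, [K] being infinite. *)
Lemma null_constants (Cs : seq A) (R : {poly A}) :
  vanishes_on [seq c%:P | c <- Cs] R -> radical [seq c%:P | c <- Cs] R.
Proof.
move=> hR; apply: radical_coefs => i; apply: (radical_morph (@polyC A)); apply: nullA => x hx.
have /polyP/(_ i) : map_poly (ev x) R = 0.
  apply: poly_infinite => t; apply: hR => _ /mapP[c sc ->].
  by rewrite evpC hx.
by rewrite coef_map coef0.
Qed.

Lemma dvdp_exp_roots (p r : {poly K}) :
  p != 0 -> (forall t, p.[t] = 0 -> r.[t] = 0) -> p %| r ^+ size p.
Proof.
move=> nzp pr; have [rs def_p] := closed_field_poly_normal p.
have lc0 : lead_coef p != 0 by rewrite lead_coef_eq0.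
have rs_r z : z \in rs -> 'X - z%:P %| r.
  move=> rs_z; rewrite dvdp_XsubCl; apply/eqP/pr.
  by rewrite def_p hornerZ horner_prod (big_rem z) //= hornerXsubC subrr mul0r mulr0.
have size_p : size p = (size rs).+1.
  by rewrite def_p size_scale // size_prod_XsubC.
rewrite {1}def_p dvdpZl // size_p exprS dvdp_mull //.
elim: {def_p size_p} rs rs_r => [|z rs IHrs] rs_r; first by rewrite big_nil dvd1p.
rewrite big_cons exprS dvdp_mul ?rs_r ?mem_head // IHrs // => y rs_y.
by rewrite rs_r // mem_behead.
Qed.

(** Over a point where the leading coefficient [a] of [P] is nonzero, the
    hypothesis says that the roots of [P] are roots of [R], that is, [P] divides
    a power of [R].  Pseudo-division of that power by [P] leaves a remainder
    whose coefficients thus vanish wherever [a] does not, and these are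
    constants, to which the Nullstellensatz over [A] applies. *)
Lemma null_one (Cs : seq A) (P R : {poly A}) :
    vanishes_on (P :: [seq c%:P | c <- Cs]) ((lead_coef P)%:P * R) ->
  radical (P :: [seq c%:P | c <- Cs]) ((lead_coef P)%:P * R).
Proof.
set s := P :: _; set a := lead_coef P => hR.
have [P0|nzP] := eqVneq P 0.
  rewrite /a P0 lead_coef0 mul0r; exact: ideal0 (radical_ideal _).
have ri := radical_ideal s.
have := Pdiv.ComRing.rdivp_eq P (R ^+ size P).
have := Pdiv.CommonRing.ltn_rmodpN0 (R ^+ size P) nzP.
set S := Pdiv.CommonRing.rmodp _ _; set q := Pdiv.CommonRing.rdivp _ _.
set l := Pdiv.CommonRing.rscalp _ _ => ltS defS.
have radS : radical s (a%:P * S).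
  apply: (@radical_trans _ [seq c%:P | c <- Cs]) => [p sp|].
    by apply: mem_radical; rewrite inE sp orbT.
  apply: radical_coefs => i; apply: (radical_morph (@polyC A)); apply: nullA => x hx.
  rewrite coefCM rmorphM; have [->|nza] := eqVneq (ev x a) 0; first by rewrite mul0r.
  suff /polyP/(_ i) : map_poly (ev x) S = 0 by rewrite coef_map coef0 => ->; rewrite mulr0.
  set p := map_poly (ev x) P.
  have size_p : size p = size P by apply: size_poly_eq.
  have nzp : p != 0 by rewrite -size_poly_eq0 size_p size_poly_eq0.
  have pr : p %| map_poly (ev x) R ^+ size P.
    rewrite -size_p; apply: dvdp_exp_roots => // t pt.
    have : evp x t (a%:P * R) = 0; last first.
      by rewrite evpM evpC => /eqP; rewrite mulf_eq0 (negPf nza) => /eqP.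
    by apply: hR => u; rewrite inE => /predU1P[->//|/mapP[c sc ->]]; rewrite evpC hx.
  apply/eqP; rewrite -size_poly_eq0; apply/negPn/negP => nzS.
  have : p %| map_poly (ev x) S.
    have -> : S = (a ^+ l) *: R ^+ size P - q * P by rewrite defS addrC addKr.
    rewrite rmorphB /= [map_poly _ (q * P)]rmorphM; apply: dvdp_sub; last exact: dvdp_mull.
    by rewrite -mul_polyC rmorphM /= dvdp_mull //= rmorphXn.
  move/dvdp_leq; rewrite -size_poly_eq0 => /(_ nzS).
  rewrite size_p leqNgt => /negP; apply.
  by apply: leq_ltn_trans ltS; apply: size_poly.
have radaR : radical s (a%:P * (a ^+ l *: R ^+ size P)).
  rewrite defS mulrDr; apply: (idealD ri) => //; rewrite mulrA; apply: (idealM ri).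
  by apply: mem_radical; apply: mem_head.
(* An exponent for which the power contains both [a ^+ l.+1] and
   [R ^+ size P]. *)
apply: (@radicalX _ _ _ (l.+1 + size P)).
have -> : (a%:P * R) ^+ (l.+1 + size P)
        = (a%:P ^+ size P * R ^+ l.+1) * (a%:P * (a ^+ l *: R ^+ size P)).
  rewrite exprMn !exprD [a%:P ^+ l.+1 * _]mulrC mulrACA.
  by rewrite -mul_polyC polyC_exp [a%:P ^+ l.+1]exprS -[in LHS](mulrA a%:P).
exact: (idealM ri).
Qed.

Definition total_size (Ps : seq {poly A}) := (\sum_(p <- Ps) (size p).+1)%N.

Lemma perm_vanishes (s s' : seq {poly A}) R :
  s =i s' -> vanishes_on s R -> vanishes_on s' R.
Proof. by move=> ss' hR x t hx; apply: hR => p sp; apply: hx; rewrite -ss'. Qed.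

Lemma eq_mem_radical (s s' : seq {poly A}) R :
  s =i s' -> radical s R -> radical s' R.
Proof.
move=> ss'; apply: radical_trans => p sp.
by apply: mem_radical; rewrite -ss'.
Qed.

Lemma size_drop_lead (p : {poly A}) : (1 < size p)%N ->
  (size (p - lead_coef p *: 'X^((size p).-1))%R < size p)%N.
Proof.
move=> p1; have p0 : (0 < size p)%N by apply: ltnW.
rewrite -[X in (_ < X)%N](prednK p0) ltnS; apply/leq_sizeP => j.
rewrite leq_eqVlt => /predU1P[<-|lt_j]; rewrite coefB coefZ coefXn.
  by rewrite eqxx mulr1 subrr.
rewrite gtn_eqF // mulr0 subr0 nth_default //.
by rewrite -(prednK p0).
Qed.

(** Euclid's algorithm in the variable.  Of two non-constant equations, the one
    of lower degree either has a vanishing leading coefficient, and is truncated,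
    or it reduces the other one by pseudo-division; [radical_split] puts the two
    cases together.  Constants leave the list [Ps], so each step lowers its
    total size. *)
Lemma null_poly_aux n (Ps : seq {poly A}) (Cs : seq A) R :
  (total_size Ps <= n)%N -> vanishes_on (Ps ++ [seq c%:P | c <- Cs]) R ->
  radical (Ps ++ [seq c%:P | c <- Cs]) R.
Proof.
elim: n Ps Cs R => [|n IHn] Ps Cs R.
  by case: Ps => [_|p Ps]; [apply: null_constants | rewrite /total_size big_cons].
case: Ps => [_|P Ps]; first exact: null_constants.
have small P' Ps' : (total_size (P' :: Ps') <= n.+1)%N -> (size P' <= 1)%N ->
    vanishes_on ((P' :: Ps') ++ [seq c%:P | c <- Cs]) R ->
    radical ((P' :: Ps') ++ [seq c%:P | c <- Cs]) R.
  rewrite /total_size big_cons => wP /size1_polyC -> hR.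
  have Ei : Ps' ++ [seq c%:P | c <- P'`_0 :: Cs]
             =i ((P'`_0)%:P :: Ps') ++ [seq c%:P | c <- Cs].
    by move=> p; rewrite /= !(inE, mem_cat) orbCA.
  apply: (eq_mem_radical Ei); apply: IHn.
    by rewrite -ltnS (leq_trans _ wP) // addSn ltnS leq_addl.
  by apply: perm_vanishes hR => p; rewrite Ei.
(* Where its leading coefficient vanishes, an equation may be truncated. *)
have trunc P' Ps' : (total_size (P' :: Ps') <= n.+1)%N -> (1 < size P')%N ->
    vanishes_on ((P' :: Ps') ++ [seq c%:P | c <- Cs]) R ->
    radical ((lead_coef P')%:P :: (P' :: Ps') ++ [seq c%:P | c <- Cs]) R.
  rewrite /total_size big_cons => wP P1 hR.
  pose a := lead_coef P'; pose P'' := P' - a *: 'X^((size P').-1).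
  have : radical ((P'' :: Ps') ++ [seq c%:P | c <- a :: Cs]) R.
    apply: IHn.
      rewrite /total_size big_cons -ltnS (leq_trans _ wP) // ltn_add2r ltnS.
      exact: size_drop_lead.
    move=> x t hx; apply: hR => p; rewrite /= inE => /predU1P[->|sp].
      have ha : evp x t a%:P = 0 by apply: hx; rewrite /= !(inE, mem_cat) eqxx !orbT.
      have : evp x t P'' = 0 by apply: hx; rewrite /= inE eqxx.
      by rewrite evpB evpZ -(evpC x t) ha mul0r subr0.
    by apply: hx; move: sp; rewrite /= !(inE, mem_cat) => /orP[]->; rewrite ?orbT.
  apply: radical_trans => p; rewrite /= inE => /predU1P[->|].
    set s := _ :: _; have ri := radical_ideal s.
    apply: (idealD ri) => //; first by apply: mem_radical; rewrite !inE eqxx orbT.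
    apply: (idealN ri) => //; rewrite -mul_polyC mulrC; apply: (idealM ri) => //.
    by apply: mem_radical; rewrite inE eqxx.
  rewrite !(inE, mem_cat) => sp; apply: mem_radical.
  rewrite /= !(inE, mem_cat).
  by case/or3P: sp => ->; rewrite ?orbT.
have two P1 P2 Ps' : (total_size [:: P1, P2 & Ps'] <= n.+1)%N ->
    (1 < size P1)%N -> (size P1 <= size P2)%N ->
    vanishes_on ([:: P1, P2 & Ps'] ++ [seq c%:P | c <- Cs]) R ->
    radical ([:: P1, P2 & Ps'] ++ [seq c%:P | c <- Cs]) R.
  move=> wP P1_1 P12 hR; apply: radical_split; last exact: trunc.
  have nzP1 : P1 != 0 by rewrite -size_poly_gt0 ltnW.
  set a := lead_coef P1.
  have := Pdiv.ComRing.rdivp_eq P1 P2.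
  have := Pdiv.CommonRing.ltn_rmodpN0 P2 nzP1.
  set S := Pdiv.CommonRing.rmodp _ _; set q := Pdiv.CommonRing.rdivp _ _.
  set l := Pdiv.CommonRing.rscalp _ _ => ltS defS.
  have : radical ([:: P1, S & Ps'] ++ [seq c%:P | c <- Cs]) (a%:P * R).
    apply: IHn.
      move: wP; rewrite /total_size !big_cons => wP; rewrite -ltnS (leq_trans _ wP) //.
      by rewrite ltn_add2l ltn_add2r ltnS (leq_trans ltS).
    move=> x t hx; rewrite evpM evpC.
    have [->|nza] := eqVneq (ev x a) 0; first by rewrite mul0r.
    rewrite [evp x t R]hR ?mulr0 // => p; rewrite /= !inE.
    have P1x : evp x t P1 = 0 by apply: hx; rewrite inE eqxx.
    case/or3P=> [/eqP->|/eqP->|sp] //; last by apply: hx; rewrite /= !inE sp !orbT.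
    have : evp x t (a ^+ l *: P2) = 0.
      rewrite defS -[S]opprK evpB -[- S]add0r evpB evp0 evpM P1x mulr0.
      by rewrite (hx S) ?inE ?eqxx ?orbT // !subr0.
    by rewrite evpZ rmorphXn => /eqP; rewrite mulf_eq0 expf_eq0 (negPf nza) andbF => /eqP.
  apply: radical_trans => p; rewrite /= !inE.
  have gi := radical_ideal (P1 :: P2 :: Ps' ++ [seq c%:P | c <- Cs]).
  have mem u : u \in P1 :: P2 :: Ps' ++ [seq c%:P | c <- Cs] ->
      radical (P1 :: P2 :: Ps' ++ [seq c%:P | c <- Cs]) u.
    by move=> su; apply: mem_radical.
  case/or3P=> [/eqP->|/eqP->|sp].
  - by apply: mem; rewrite mem_head.
  - have -> : S = (a ^+ l)%:P * P2 - q * P1 by rewrite mul_polyC defS addrC addKr.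
    apply: (idealD gi) => //; first by apply: (idealM gi) => //; apply: mem; rewrite !inE eqxx orbT.
    by apply: (idealN gi) => //; apply: (idealM gi) => //; apply: mem; rewrite mem_head.
  - by apply: mem; rewrite !inE sp !orbT.
move=> wP hR; have [P1|P1] := leqP (size P) 1; first exact: small.
case: Ps wP hR => [|P2 Ps] wP hR.
  apply: radical_split; last exact: trunc.
  apply: null_one => x t hx; rewrite evpM [evp x t R]hR ?mulr0 // => p.
have swap : P :: P2 :: Ps ++ [seq c%:P | c <- Cs]
         =i P2 :: P :: Ps ++ [seq c%:P | c <- Cs].
  by move=> p; rewrite !inE orbCA.
have wP' : (total_size [:: P2, P & Ps] <= n.+1)%N by move: wP; rewrite /total_size !big_cons addnCA.
have [P21|P21] := leqP (size P2) 1.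
  apply: eq_mem_radical (small _ _ wP' P21 _) => [p|]; first by rewrite -swap.
  exact: perm_vanishes hR.
have [P12|P12] := leqP (size P) (size P2); first exact: two.
apply: eq_mem_radical (two _ _ _ wP' P21 (ltnW P12) _) => [p|]; first by rewrite -swap.
exact: perm_vanishes hR.
Qed.

Lemma null_poly (s : seq {poly A}) R : vanishes_on s R -> radical s R.
Proof.
by move=> hR; have := @null_poly_aux _ s [::] R (leqnn _); rewrite /= cats0; apply.
Qed.

End NullstellensatzStep.

Section Nullstellensatz.
Local Open Scope ring_scope.
Variable K : closedFieldType.

Lemma mpoly_rmorph_ext n (B : comNzRingType) (f g : {rmorphism {mpoly K[n]} -> B}) :
  (forall c, f c%:MP = g c%:MP) -> (forall i, f 'X_i = g 'X_i) -> f =1 g.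
Proof.
move=> fgC fgX; elim/mpolyind => [|c m p _ _ IHp]; first by rewrite !rmorph0.
rewrite !rmorphD IHp -mul_mpolyC !rmorphM fgC mpolyXE_id !rmorph_prod; congr (_ * _ + _).
by apply: eq_bigr => i _; rewrite !rmorphXn fgX.
Qed.

Lemma mwiden_meval n (p : {mpoly K[n]}) (v : 'I_n.+1 -> K) :
  (mwiden p).@[v] = p.@[fun i => v (widen_ord (leqnSn n) i)].
Proof.
apply: (mpoly_rmorph_ext (f := meval v \o @mwiden n K)) => [c|i] /=.
  by rewrite mwidenC !mevalC.
by rewrite mwidenX mnmwiden1 !mevalXU.
Qed.

(** Surjectivity and compatibility with evaluation carry the Nullstellensatz
    from univariate polynomials over the ring in [n] variables to one more
    variable. *)
Definition of_poly n : {poly {mpoly K[n]}} -> {mpoly K[n.+1]} :=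
  horner_eval 'X_ord_max \o map_poly (@mwiden n K).
HB.instance Definition _ n := GRing.RMorphism.on (@of_poly n).

Lemma of_poly_surj n (p : {mpoly K[n.+1]}) : exists q, of_poly q = p.
Proof.
have fC c : of_poly (c%:MP)%:P = c%:MP :> {mpoly K[n.+1]}.
  by rewrite /of_poly /= map_polyC /= mwidenC /horner_eval hornerC.
have fX (i : 'I_n.+1) : exists q, of_poly q = 'X_i.
  case: (unliftP ord_max i) => [j ->|->]; last first.
    by exists 'X; rewrite /of_poly /= map_polyX /horner_eval hornerX.
  exists ('X_j)%:P; rewrite /of_poly /= map_polyC /horner_eval hornerC /=.
  rewrite mwidenX mnmwiden1; congr 'X_ _; apply/val_inj.
  by rewrite /= /bump leqNgt ltn_ord.
elim/mpolyind: p => [|c m p _ _ [q <-]]; first by exists 0; rewrite rmorph0.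
have [r defr] : exists r, of_poly r = 'X_[m].
  rewrite mpolyXE_id; elim/big_rec: _ => [|i u _ [r <-]]; first by exists 1; rewrite rmorph1.
  by have [s <-] := fX i; exists (s ^+ m i * r); rewrite rmorphM rmorphXn.
by exists ((c%:MP)%:P * r + q); rewrite rmorphD rmorphM /= fC defr mul_mpolyC.
Qed.

Lemma of_poly_meval n (w : 'I_n -> K) (t : K) :
  exists v : 'I_n.+1 -> K, forall q, (of_poly q).@[v] = evp (@meval n K) w t q.
Proof.
exists (fun i => oapp w t (unlift ord_max i)) => r.
rewrite /of_poly /horner_eval /= -horner_map -map_poly_comp /= mevalXU unlift_none /=.
rewrite /evp; congr (_.[_]); apply: eq_map_poly => p /=.
rewrite mwiden_meval; apply: meval_eq => i.
have -> : widen_ord (leqnSn n) i = lift ord_max i.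
  by apply/val_inj; rewrite /= /bump leqNgt ltn_ord.
by rewrite liftK.
Qed.

(** Induction on the number of variables.  Without variables, a nonzero
    generator is invertible. *)
Theorem nullstellensatz n (s : seq {mpoly K[n]}) (R : {mpoly K[n]}) :
  (forall v, (forall p, p \in s -> p.@[v] = 0) -> R.@[v] = 0) -> radical s R.
Proof.
elim: n s R => [|n IHn] s R hR.
  have mC (p : {mpoly K[0]}) : p = (p.@[fun=> 0])%:MP.
    elim/mpolyind: p => [|c m p _ _ {1}->]; first by rewrite raddf0 mpolyC0.
    rewrite -mul_mpolyC mevalD mevalM mevalC mpolyCD mpolyCM mpolyXE_id !big_ord0.
    by rewrite meval1 mpolyC1.
  case: (boolP (all (fun p => p == 0) s)) => [/allP s0|/allPn[p sp nzp]].
    rewrite (mC R) hR ?mpolyC0; first exact: ideal0 (radical_ideal _).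
    by move=> p /s0/eqP->; rewrite meval0.
  have nzc : p.@[fun=> 0] != 0 by apply: contraNneq nzp => p0; rewrite (mC p) p0 mpolyC0.
  apply: generated_radical; have gi := generated_ideal s.
  have -> : R = (R * (p.@[fun=> 0])^-1%:MP) * p.
    by rewrite {2}(mC p) -mulrA -mpolyCM mulVf // mpolyC1 mulr1.
  by apply: (idealM gi) => //; apply: mem_generated.
have [R' defR] := of_poly_surj R.
have [s' defs] : exists s', s = [seq of_poly q | q <- s'].
  elim: s {hR} => [|p s [s' ->]]; first by exists [::].
  by have [q <-] := of_poly_surj p; exists (q :: s').
rewrite -defR defs; apply: radical_morph.
apply: (null_poly (ev := @meval n K)) => // w t hx.
have [v hv] := of_poly_meval w t.
rewrite -hv defR; apply: hR => p; rewrite defs => /mapP[q sq ->].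
by rewrite hv hx.
Qed.

End Nullstellensatz.

(** * Cech cochains over a domain *)

Section Cochains.
Local Open Scope ring_scope.
Variables (Q : comNzRingType) (T : eqType).
Implicit Types (w v : T -> Q) (c : seq T -> Q) (s : seq T).

(** The alternating sum, over the positions of [s], of the weight of the letter
    there times the value of [c] on [s] without that position.  With weight 1
    this is the Cech coboundary; other weights behave like interior products by
    vectors. *)
Fixpoint contraction w c s : Q :=
  if s is t :: s' then w t * c s' - contraction w (fun u => c (t :: u)) s' else 0.

Definition coboundary := contraction (fun=> 1).

Lemma contraction_closed (P : Q -> Prop) w c s :
    P 0 -> (forall a b, P a -> P b -> P (a - b)) ->
    (forall t q, t \in s -> P q -> P (w t * q)) ->
    (forall u, subseq u s -> size s = (size u).+1 -> P (c u)) ->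
  P (contraction w c s).
Proof.
move=> P0 PB; elim: s c => [|t s IHs] c //= Pw Pc.
apply: PB; first by apply: Pw; rewrite ?mem_head //; apply: Pc => //; apply: subseq_cons.
apply: IHs => [t' q st'|u us Es]; first by apply: Pw; rewrite inE st' orbT.
by apply: Pc; rewrite ?eqxx //= Es.
Qed.

Lemma contraction_lin w a c c' s :
  contraction w (fun u => a * c u + c' u) s = a * contraction w c s + contraction w c' s.
Proof.
elim: s c c' => [|t s IHs] c c' /=; first by rewrite mulr0 addr0.
rewrite (IHs (fun u => c (t :: u)) (fun u => c' (t :: u))).
by rewrite mulrDr mulrCA mulrBr opprD addrACA.
Qed.

Lemma contraction_linl w w' a c s :
  contraction (fun t => a * w t + w' t) c s = a * contraction w c s + contraction w' c s.
Proof.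
elim: s c => [|t s IHs] c /=; first by rewrite mulr0 addr0.
by rewrite IHs mulrDl mulrBr opprD addrACA mulrA.
Qed.

Lemma eq_contraction w c c' s :
  (forall u, subseq u s -> size s = (size u).+1 -> c u = c' u) ->
  contraction w c s = contraction w c' s.
Proof.
elim: s c c' => [|t s IHs] c c' //= cc'; congr (_ * _ - _).
  by apply: cc' => //; apply: subseq_cons.
by apply: IHs => u us Es; apply: cc'; rewrite ?eqxx //= Es.
Qed.

Lemma eq_contractionl w w' c s : {in s, w =1 w'} -> contraction w c s = contraction w' c s.
Proof.
elim: s c => [|t s IHs] c //= ww'; rewrite ww' ?mem_head // IHs // => u su.
by rewrite ww' // inE su orbT.
Qed.

Lemma contraction0 w c s :
    (forall u, subseq u s -> size s = (size u).+1 -> c u = 0) ->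
  contraction w c s = 0.
Proof.
move=> c0; apply: (contraction_closed (P := fun q => q = 0)) => // [a b -> ->|t q _ ->].
  by rewrite subr0.
by rewrite mulr0.
Qed.

Lemma contraction0l w c s : {in s, forall t, w t = 0} -> contraction w c s = 0.
Proof.
elim: s c => [|t s IHs] c //= w0; rewrite w0 ?mem_head // mul0r sub0r IHs ?oppr0 //.
by move=> u su; rewrite w0 // inE su orbT.
Qed.

Lemma contractionB w c c' s :
  contraction w (fun u => c u - c' u) s = contraction w c s - contraction w c' s.
Proof.
have := contraction_lin w (-1) c' c s; rewrite mulN1r [- _ + _]addrC => <-.
by apply: eq_contraction => u _ _; rewrite mulN1r addrC.
Qed.

Lemma contractionD w c c' s :
  contraction w (fun u => c u + c' u) s = contraction w c s + contraction w c' s.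
Proof.
have := contraction_lin w 1 c c' s; rewrite mul1r => <-.
by apply: eq_contraction => u _ _; rewrite mul1r.
Qed.

Lemma contractionZ w a c s :
  contraction w (fun u => a * c u) s = a * contraction w c s.
Proof.
have := contraction_lin w a c (fun=> 0) s.
rewrite [contraction w (fun=> 0) s]contraction0 // addr0 => <-.
by apply: eq_contraction => u _ _; rewrite addr0.
Qed.

(** Together with [contraction_sqr], the exterior algebra relations; that the
    coboundary squares to zero is a special case. *)
Lemma contraction_anticomm w v c s :
  contraction w (contraction v c) s = - contraction v (contraction w c) s.
Proof.
elim: s c => [|t s IHs] c /=; first by rewrite oppr0.
have E w' v' : contraction w' (fun u => v' t * c u - contraction v' (fun u0 => c (t :: u0)) u) s
    = v' t * contraction w' c s - contraction w' (contraction v' (fun u => c (t :: u))) s.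
  by rewrite contractionB contractionZ.
by rewrite !E IHs opprK opprD addrA [RHS]opprB addrAC.
Qed.

Lemma contraction_sqr w c s : contraction w (contraction w c) s = 0.
Proof.
elim: s c => [|t s IHs] c //=.
by rewrite contractionB contractionZ IHs subr0 subrr.
Qed.

(** Adding a letter in front is a contracting homotopy. *)
Lemma coboundary_cons c t s :
  coboundary c (t :: s) = c s - coboundary (fun u => c (t :: u)) s.
Proof. by rewrite /coboundary /= mul1r. Qed.

(** Restriction to an alphabet, extended by zero to the other sequences: this is
    how cochains on part of a cover are used on all of it. *)
Definition restriction (L : seq T) c s : Q := if all (mem L) s then c s else 0.

Lemma restrictionT L c s : {subset s <= L} -> restriction L c s = c s.
Proof. by move=> sL; rewrite /restriction; case: allP => // -[]. Qed.

Lemma contraction_restriction L w c s :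
  {subset s <= L} -> contraction w (restriction L c) s = contraction w c s.
Proof.
move=> sL; apply: eq_contraction => u us _; apply: restrictionT => t ut.
by apply: sL; apply: (mem_subseq us).
Qed.

End Cochains.

(** Cochains of a given degree on a finite cover have finitely many values, so
    their denominators can be cleared by a single exponent. *)
Lemma fin_uniform_bound (I : finType) (P : I -> nat -> Prop) :
    (forall i m n, (m <= n)%N -> P i m -> P i n) -> (forall i, exists n, P i n) ->
  exists n, forall i, P i n.
Proof.
move=> mono /fin_all_exists[n Pn]; exists (\max_i n i) => i.
exact: mono (leq_bigmax i) (Pn i).
Qed.

Section Cech.
Local Open Scope ring_scope.
Variables (A : idomainType) (T : finType) (h : T -> A).
Local Notation Q := {fraction A}.
Local Notation "x %:F" := (tofrac x).
Hypothesis h_neq0 : forall t, h t != 0.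
Implicit Types (s u ys L : seq T) (c b : seq T -> Q) (Z : pred (seq T)).

Definition seq_prod s : A := \prod_(t <- s) h t.

(** [q] is a section of the structure sheaf over the open set where the letters
    of [s] do not vanish. *)
Definition regular s (q : Q) : Prop := exists n (a : A), q * (seq_prod s ^+ n)%:F = a%:F.

Lemma seq_prod_neq0 s : seq_prod s != 0.
Proof. by rewrite /seq_prod; elim/big_rec: _ => [|t p _ np]; rewrite ?oner_neq0 ?mulf_neq0. Qed.

Lemma seq_prod_dvd s u : {subset u <= s} -> exists n a, seq_prod s ^+ n = a * seq_prod u.
Proof.
elim: u => [|t u IHu] us.
  by exists 0%N, 1; rewrite /seq_prod big_nil mulr1.
have [|n [a En]] := IHu; first by move=> x ux; rewrite us // inE ux orbT.
exists n.+1, (a * (\prod_(x <- rem t s) h x)).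
rewrite exprSr En [in RHS]/seq_prod big_cons {2}/seq_prod (big_rem t) ?us ?mem_head //=.
by rewrite -!mulrA; congr (_ * _); rewrite mulrCA [RHS]mulrCA; congr (_ * _); rewrite mulrC.
Qed.

Lemma regular_sub s u q : {subset u <= s} -> regular u q -> regular s q.
Proof.
move=> us [n [a Eq]]; have [m [r Er]] := seq_prod_dvd us.
exists (m * n)%N, (r ^+ n * a).
by rewrite exprM Er exprMn rmorphM mulrCA Eq -rmorphM.
Qed.

Lemma regular_common s q q' : regular s q -> regular s q' ->
  exists n a a', q * (seq_prod s ^+ n)%:F = a%:F /\ q' * (seq_prod s ^+ n)%:F = a'%:F.
Proof.
case=> n [a Eq] [n' [a' Eq']]; exists (n + n')%N, (a * seq_prod s ^+ n').
exists (a' * seq_prod s ^+ n); split; first by rewrite exprD !rmorphM mulrA Eq.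
by rewrite addnC exprD !rmorphM mulrA Eq'.
Qed.

Lemma regularA s a : regular s a%:F.
Proof. by exists 0%N, a; rewrite expr0 rmorph1 mulr1. Qed.

Lemma regular0 s : regular s 0.
Proof. by rewrite -(rmorph0 (@tofrac A)); apply: regularA. Qed.

Lemma regularB s q q' : regular s q -> regular s q' -> regular s (q - q').
Proof.
move=> rq rq'; have [n [a [a' [Eq Eq']]]] := regular_common rq rq'.
by exists n, (a - a'); rewrite mulrBl Eq Eq' rmorphB.
Qed.

Lemma regularD s q q' : regular s q -> regular s q' -> regular s (q + q').
Proof.
move=> rq rq'; have [n [a [a' [Eq Eq']]]] := regular_common rq rq'.
by exists n, (a + a'); rewrite mulrDl Eq Eq' rmorphD.
Qed.

Lemma regularM s q q' : regular s q -> regular s q' -> regular s (q * q').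
Proof.
case=> n [a Eq] [n' [a' Eq']]; exists (n + n')%N, (a * a').
by rewrite exprD !rmorphM mulrACA Eq Eq'.
Qed.

Lemma regularV s n : regular s (seq_prod s ^+ n)%:F^-1.
Proof.
by exists n, 1; rewrite mulVf ?rmorph1 // tofrac_eq0 expf_neq0 // seq_prod_neq0.
Qed.

Lemma contraction_regular w c s :
    (forall t, t \in s -> regular [:: t] (w t)) ->
    (forall u, {subset u <= s} -> regular u (c u)) ->
  regular s (contraction w c s).
Proof.
move=> rw rc; apply: contraction_closed => [|q q'|t q st|u us _].
- exact: regular0.
- exact: regularB.
- move=> rq; apply: regularM => //; apply: regular_sub (rw t st) => x.
  by rewrite inE => /eqP->.
- apply: (@regular_sub _ u); first exact: mem_subseq.
  by apply: rc; apply: mem_subseq.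
Qed.

Section Exactness.
Variable Z : pred (seq T).
Hypothesis Z_sub : forall s u, {subset u <= s} -> Z s -> Z u.

(** Cochains on the cover indexed by the alphabet [L], over the open set where
    the letters of [ys] do not vanish, relative to the sequences in [Z].  The
    degree is counted by the length [k] of the sequences, and [e = 1] is used
    for cochains whose coboundary has length [k]. *)
Definition is_cochain (L ys : seq T) (e k : nat) c : Prop :=
  forall s, {subset s <= L} ->
    [/\ regular (ys ++ s) (c s), Z (ys ++ s) -> c s = 0 & (e + size s)%N <> k -> c s = 0].

Definition exact_on (L ys : seq T) (k : nat) : Prop :=
  forall c, is_cochain L ys 0 k c -> (forall s, {subset s <= L} -> coboundary c s = 0) ->
  exists2 b, is_cochain L ys 1 k b & forall s, {subset s <= L} -> coboundary b s = c s.

Lemma cat_sub (s u v w : seq T) :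
  {subset s <= u} -> {subset v <= w} -> {subset s ++ v <= u ++ w}.
Proof. by move=> su vw x; rewrite !mem_cat => /orP[/su->|/vw->]; rewrite ?orbT. Qed.

Lemma cochain0 L ys e k : is_cochain L ys e k (fun=> 0).
Proof. by move=> s _; split=> //; apply: regular0. Qed.

Lemma cochainB L ys e k c c' :
  is_cochain L ys e k c -> is_cochain L ys e k c' -> is_cochain L ys e k (fun s => c s - c' s).
Proof.
move=> hc hc' s sL; have [r z k1] := hc s sL; have [r' z' k1'] := hc' s sL.
by split=> [|zs|ks]; [apply: regularB | rewrite z ?z' ?subr0 | rewrite k1 ?k1' ?subr0].
Qed.

Lemma cochainD L ys e k c c' :
  is_cochain L ys e k c -> is_cochain L ys e k c' -> is_cochain L ys e k (fun s => c s + c' s).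
Proof.
move=> hc hc' s sL; have [r z k1] := hc s sL; have [r' z' k1'] := hc' s sL.
by split=> [|zs|ks]; [apply: regularD | rewrite z ?z' ?addr0 | rewrite k1 ?k1' ?addr0].
Qed.

Lemma cochainZ L ys e k q c :
  regular ys q -> is_cochain L ys e k c -> is_cochain L ys e k (fun s => q * c s).
Proof.
move=> rq hc s sL; have [r z k1] := hc s sL.
split=> [|zs|ks]; [|by rewrite z ?mulr0 | by rewrite k1 ?mulr0].
by apply: regularM => //; apply: regular_sub rq => x; rewrite mem_cat => ->.
Qed.

Lemma cochain_coboundary L ys k c :
  is_cochain L ys 1 k c -> is_cochain L ys 0 k (coboundary c).
Proof.
move=> hc s sL.
have sub u : subseq u s -> {subset u <= L} by move=> /mem_subseq us x /us /sL.
split=> [|zs|ks].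
- apply: contraction_closed => [|q q'|t q _|u us _]; first exact: regular0.
  + exact: regularB.
  + by rewrite mul1r.
  + have [r _ _] := hc u (sub u us); apply: regular_sub r.
    by apply: cat_sub => // x; apply: mem_subseq.
- apply: contraction0 => u us _; have [_ z _] := hc u (sub u us); apply: z.
  by apply: Z_sub zs; apply: cat_sub => // x; apply: mem_subseq.
- apply: contraction0 => u us Es; have [_ _ k1] := hc u (sub u us); apply: k1.
  by move: ks; rewrite Es.
Qed.

(** Adding the letter [x] to the cover.  A cocycle on [x :: L] is first made zero
    on the sequences that avoid [x].  Putting [x] in front then writes it as a
    coboundary, except that the values on sequences without [x] acquire the
    denominator [x]; these values form a cocycle over the open set of [x],
    which the second hypothesis removes. *)
Lemma peel L x ys k :
  exact_on L ys k -> exact_on L (x :: ys) k.-1 -> exact_on (x :: L) ys k.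
Proof.
move=> exL exx; have [Lx|nLx] := boolP (x \in L).
  have EL s : {subset s <= x :: L} <-> {subset s <= L}.
    split=> sL t /sL; rewrite inE; first by case/predU1P=> [->|].
    by move=> ->; rewrite orbT.
  move=> c hc dc; have [||b hb db] := exL c.
  - by move=> s /EL; apply: hc.
  - by move=> s /EL; apply: dc.
  by exists b => s /EL; [apply: hb | apply: db].
have subL s : {subset s <= L} -> {subset s <= x :: L}.
  by move=> sL t /sL; rewrite inE => ->; rewrite orbT.
have noxL s : {subset s <= L} -> x \notin s by move=> sL; apply: contraNN nLx => /sL.
have nox s : {subset s <= x :: L} -> x \notin s -> {subset s <= L}.
  move=> sL nsx t st; move/sL: (st); rewrite inE => /predU1P[tx|//].
  by rewrite -tx st in nsx.
move=> c hc dc; pose ext (a : seq T -> Q) s := if x \in s then 0 else a s.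
have dext a s : {subset s <= L} -> coboundary (ext a) s = coboundary a s.
  move=> sL; apply: eq_contraction => u us _; rewrite /ext (negPf (noxL u _)) //.
  by move=> t /(mem_subseq us)/sL.
have hext a e k' : is_cochain L ys e k' a -> is_cochain (x :: L) ys e k' (ext a).
  move=> ha s sL; rewrite /ext; case: ifPn => [_|nsx]; first by split=> //; apply: regular0.
  exact: ha (nox s sL nsx).
have [||b0 hb0 db0] := exL c.
- by move=> s /subL; apply: hc.
- by move=> s /subL; apply: dc.
pose c1 s := c s - coboundary (ext b0) s.
have hc1 : is_cochain (x :: L) ys 0 k c1.
  by apply: cochainB hc _; apply: cochain_coboundary; apply: hext.
have c1L s : {subset s <= L} -> c1 s = 0 by move=> sL; rewrite /c1 dext // db0 ?subrr.
have dc1 s : {subset s <= x :: L} -> coboundary c1 s = 0.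
  move=> sL; have := dc s sL; rewrite /coboundary /c1 contractionB => ->.
  by rewrite contraction_sqr subrr.
have subx s : {subset s <= x :: L} -> {subset x :: s <= x :: L}.
  by move=> sL t; rewrite inE => /predU1P[->|/sL//]; apply: mem_head.
have [||g hg dg] := exx (fun s => c1 (x :: s)).
- move=> s sL; have [r z ks] := hc1 _ (subx s (subL s sL)).
  split=> [|zs|ne].
  + by apply: regular_sub r => t; rewrite /= !(inE, mem_cat) orbCA.
  + by apply: z; apply: Z_sub zs => t; rewrite /= !(inE, mem_cat) orbCA.
  + by apply: ks; move: ne; rewrite !add0n /=; case: (k) => // k' ne [/ne].
- move=> s sL; have := dc1 _ (subx s (subL s sL)).
  rewrite coboundary_cons c1L // sub0r => /eqP; rewrite oppr_eq0 => /eqP.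
  exact.
pose b1 s := c1 (x :: s) - coboundary (ext g) s.
have hb1 : is_cochain (x :: L) ys 1 k b1.
  move=> s sL; have [sx|nsx] := boolP (x \in s); last first.
    have sL' := nox s sL nsx.
    by rewrite /b1 dext // dg // subrr; split=> //; apply: regular0.
  have [r z ks] := hc1 _ (subx s sL).
  have catx (u : seq T) : {subset u <= s} -> {subset (x :: ys) ++ u <= ys ++ s}.
    move=> us t; rewrite /= inE !mem_cat => /or3P[/eqP->|->//|/us->].
      by rewrite sx orbT.
    by rewrite orbT.
  have uL u : subseq u s -> x \notin u -> {subset u <= L}.
    by move=> us nux; apply: nox => // t /(mem_subseq us)/sL.
  split=> [|zs|ne].
  - apply: regularB.
      apply: regular_sub r => t; rewrite !mem_cat inE.
      by case/or3P=> [->|/eqP->|->]; rewrite ?sx ?orbT.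
    apply: contraction_closed => [|q q'|t q _|u us _]; first exact: regular0.
    + exact: regularB.
    + by rewrite mul1r.
    + rewrite /ext; case: ifPn => [_|nux]; first exact: regular0.
      have [r' _ _] := hg u (uL u us nux); apply: regular_sub r'.
      by apply: catx => t; apply: mem_subseq.
  - rewrite /b1 z; last first.
      apply: Z_sub zs => t; rewrite !mem_cat inE.
      by case/or3P=> [->|/eqP->|->]; rewrite ?sx ?orbT.
    rewrite [coboundary _ _]contraction0 ?subrr // => u us _.
    rewrite /ext; case: ifPn => // nux.
    have [_ z' _] := hg u (uL u us nux); apply: z'; apply: Z_sub zs.
    by apply: catx => t; apply: mem_subseq.
  - rewrite /b1 ks // [coboundary _ _]contraction0 ?subrr // => u us Es.
    rewrite /ext; case: ifPn => // nux.
    have [_ _ k'] := hg u (uL u us nux); apply: k'; move: ne; rewrite Es.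
    by case: (k) => //= k'' ne E; apply: ne; rewrite addnS E.
exists (fun s => ext b0 s + b1 s); first by apply: cochainD => //; apply: hext.
move=> s sL; rewrite /coboundary contractionD /b1 contractionB contraction_sqr subr0.
have := dc1 _ (subx s sL); rewrite coboundary_cons => /eqP; rewrite subr_eq0 => /eqP.
by rewrite /coboundary /c1 => <-; rewrite addrC subrK.
Qed.

(** Peeling off a letter lowers the degree by at most one, and without letters
    only the empty sequence is left.  Repetitions in sequences thus create no
    cohomology beyond the number of open sets. *)
Lemma exact_of_size L ys k : (size L < k)%N -> exact_on L ys k.
Proof.
elim: L ys k => [|x L IHL] ys k ltk; last first.
  apply: peel; apply: IHL; first exact: ltnW.
  by case: k ltk.
move=> c hc _; exists (fun=> 0); first exact: cochain0.
move=> s; case: s => [s0|t s /(_ t)]; last by rewrite mem_head in_nil => /(_ isT).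
by have [_ _ ->] := hc _ s0 => //; case: k ltk {hc}.
Qed.

(** A cover of an affine open set is acyclic.  Putting in front a letter [x] of
    [F] and multiplying by a power of [x] keeps the denominators, so this power
    kills cohomology; the functions that kill it form an ideal, which therefore
    contains a power of [seq_prod ys], a unit over the open set. *)
Lemma exact_contractible F ys k :
    (forall x s, x \in F -> Z s -> Z (x :: s)) ->
    (~~ Z ys -> radical [seq h x | x <- F] (seq_prod ys)) ->
  exact_on F ys k.
Proof.
move=> ZF radF c hc dc; have [Zys|nZys] := boolP (Z ys).
  exists (fun=> 0); first exact: cochain0.
  move=> s sF; rewrite [coboundary _ _]contraction0 //; have [_ -> //] := hc s sF.
  elim: s sF => [|x s IHs] sF; first by rewrite cats0.
  have : Z (x :: (ys ++ s)).
    by apply: ZF; [apply: sF; rewrite mem_head | apply: IHs => t st; rewrite sF // inE st orbT].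
  by apply: Z_sub => t; rewrite !(inE, mem_cat) orbCA.
(* The ideal of functions that kill the class of [c]. *)
pose J (a : A) := exists2 b, is_cochain F ys 1 k b &
  forall s, {subset s <= F} -> coboundary b s = a%:F * c s.
have idJ : is_ideal J.
  split.
  - exists (fun=> 0); first exact: cochain0.
    by move=> s _; rewrite [coboundary _ _]contraction0 // rmorph0 mul0r.
  - move=> a a' [b hb db] [b' hb' db']; exists (fun s => b s + b' s).
      exact: cochainD.
    by move=> s sF; rewrite /coboundary contractionD [X in X + _]db // [X in _ + X]db' // rmorphD mulrDl.
  - move=> a a' [b hb db]; exists (fun s => a%:F * b s).
      by apply: cochainZ hb; apply: regularA.
    by move=> s sF; rewrite /coboundary contractionZ [contraction _ _ _]db // rmorphM mulrA.
have [|t [b hb db]] := @radical_in _ [seq h x | x <- F] (seq_prod ys) J idJ _ (radF nZys).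
  move=> _ /mapP[x Fx ->].
  have subx s : {subset s <= F} -> {subset x :: s <= F}.
    by move=> sF u; rewrite inE => /predU1P[->|/sF].
  pose P (s : k.-1.-tuple T) n := {subset s <= F} -> regular (ys ++ s) ((h x ^+ n)%:F * c (x :: s)).
  have [||n hn] := @fin_uniform_bound _ P.
  - move=> s m n le_mn Pm sF; rewrite -(subnK le_mn) exprD rmorphM -mulrA.
    by apply: regularM; [apply: regularA | apply: Pm].
  - move=> s; have [/allP sF|] := boolP (all (mem F) s); last first.
      by move/allP=> nsF; exists 0%N => sF; case: nsF.
    have [[n [a Ea]] _ _] := hc _ (subx s sF); exists n => _; exists n, a.
    rewrite -Ea mulrAC mulrC -rmorphM -exprMn; congr (_ * (_ ^+ _)%:F).
    by rewrite /seq_prod !big_cat big_cons /= mulrCA.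
  exists n, (fun s => (h x ^+ n)%:F * c (x :: s)).
    move=> s sF; have [r z ks] := hc _ (subx s sF); split.
    + have [Ek|/eqP ne] := eqVneq (1 + size s)%N k; last first.
        by rewrite ks // mulr0; apply: regular0.
      have Es : size s == k.-1 by rewrite -Ek.
      exact: (hn (Tuple Es)).
    + by move=> Zs; case/negP: nZys; apply: Z_sub Zs => u; rewrite mem_cat => ->.
    + by move=> ne; rewrite ks // mulr0.
  move=> s sF; rewrite /coboundary contractionZ; congr (_ * _).
  have := dc _ (subx s sF); rewrite coboundary_cons => /eqP; rewrite subr_eq0 => /eqP.
  by move=> ->.
exists (fun s => (seq_prod ys ^+ t)%:F^-1 * b s).
  by apply: cochainZ => //; apply: regularV.
move=> s sF; rewrite /coboundary contractionZ [contraction _ _ _]db // mulrA mulVf ?mul1r //.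
by rewrite tofrac_eq0 expf_neq0 // seq_prod_neq0.
Qed.

(** Peeling off the letters of [L] leads to open sets covered by [F], where
    [exact_contractible] applies; the condition on the radical is what it asks
    for on those that are not in [Z]. *)
Lemma exact_relative L F ys k :
    (forall x s, x \in F -> Z s -> Z (x :: s)) ->
    (forall s, {subset s <= ys ++ L} -> ~~ Z s -> radical [seq h x | x <- F] (seq_prod s)) ->
  exact_on (L ++ F) ys k.
Proof.
move=> ZF; elim: L ys k => [|x L IHL] ys k radF.
  by apply: exact_contractible => // nZ; apply: radF => // t; rewrite cats0.
apply: peel; apply: IHL => s sL; apply: radF => t /sL.
  by rewrite !mem_cat inE => /orP[->//|->]; rewrite !orbT.
by rewrite /= !(inE, mem_cat) orbCA.
Qed.

End Exactness.

End Cech.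

(** * A Mayer-Vietoris argument *)

Section MayerVietoris.
Local Open Scope ring_scope.
Variables (A : idomainType) (T : finType) (h : T -> A).
Local Notation Q := {fraction A}.
Implicit Types (s : seq T) (c : seq T -> Q).
Hypothesis h_neq0 : forall t, h t != 0.
Variables (f g S z : seq T) (M : nat) (eta : seq T -> Q).
Hypotheses (Sf : forall t, t \in S -> t \notin f) (Sg : forall t, t \in S -> t \notin g)
  (fg : forall t, t \in f -> t \notin g)
  (zf : forall t, t \in z -> t \notin f) (zg : forall t, t \in z -> t \notin g).
Hypothesis size_S : (size S < M.-1)%N.
Hypotheses
  (rad_S : forall t, t \in S -> radical [seq h u | u <- g] (h t))
  (rad_fg : forall t u, t \in f -> u \in g -> radical [seq h v | v <- S] (h t * h u))
  (rad_z : forall t, t \in z -> radical [seq h u | u <- f ++ g] (h t)).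
Hypotheses
  (eta_regular : forall s, regular h s (eta s))
  (eta_size : forall s, size s <> M -> eta s = 0)
  (eta_cocycle : forall s, coboundary eta s = 0)
  (eta_fS : forall s, {subset s <= f ++ S} -> eta s = 0)
  (eta_g : forall s, {subset s <= g} -> eta s = 0).

Lemma radical_seq_prod (F s : seq T) t :
  t \in s -> radical [seq h u | u <- F] (h t) -> radical [seq h u | u <- F] (seq_prod h s).
Proof.
move=> st rt; rewrite /seq_prod (big_rem t) //= mulrC.
exact: (idealM (radical_ideal _)).
Qed.

Lemma radical_seq_prod2 (F s : seq T) t u : t != u ->
  t \in s -> u \in s -> radical [seq h v | v <- F] (h t * h u) ->
  radical [seq h v | v <- F] (seq_prod h s).
Proof.
move=> tu st su rt; rewrite /seq_prod (big_rem t) //= (big_rem u) /=; last first.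
  by move: su; rewrite (perm_mem (perm_to_rem st)) inE eq_sym (negPf tu).
rewrite mulrA mulrC; exact: (idealM (radical_ideal _)).
Qed.

Lemma restriction_cochain L c k :
    is_cochain h pred0 L [::] 1 k c ->
  (forall s, regular h s (restriction L c s)) /\
  (forall s, (1 + size s)%N <> k -> restriction L c s = 0).
Proof.
move=> hc; split=> s; rewrite /restriction; case: allP => sL //.
- by have [] := hc s sL.
- by apply: regular0.
- by have [_ _ k0] := hc s sL.
Qed.

Lemma cochain_pred0 Z L ys e k c :
  is_cochain h Z L ys e k c -> is_cochain h pred0 L ys e k c.
Proof. by move=> hc s sL; have [r _ k0] := hc s sL. Qed.

Lemma coboundary_regular c : (forall s, regular h s (c s)) ->
  forall s, regular h s (coboundary c s).
Proof.
move=> rc s; apply: contraction_regular => [t _|u _]; last exact: rc.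
by rewrite -(rmorph1 (@tofrac A)); apply: regularA.
Qed.

Lemma coboundary_size c k : (forall s, (1 + size s)%N <> k -> c s = 0 :> Q) ->
  forall s, size s <> k -> coboundary c s = 0.
Proof. by move=> c0 s ks; apply: contraction0 => u _ Es; apply: c0; rewrite add1n -Es. Qed.

(** [f] covers [U1], [g] covers [U2], [S] covers their intersection, and [z] is
    another cover of their union.  The restriction of [eta] to [U1] is zero, and
    its restriction to [U2] is the coboundary of [beta]; the difference of the
    two primitives, which is [beta] itself, is a cocycle on the intersection, in
    a degree where the size of [S] makes it exact.  After this correction, the
    primitives glue. *)
Theorem mayer_vietoris :
  exists2 xi, forall s, regular h s (xi s) &
    forall s, {subset s <= z} -> coboundary xi s = eta s.
Proof.
have sub_has (s u : seq T) (P : pred T) : {subset u <= s} -> has P u -> has P s.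
  by move=> us /hasP[x /us sx Px]; apply/hasP; exists x.
have no_has (L1 L2 s : seq T) : {subset s <= L1 ++ L2} -> ~~ has (mem L1) s -> {subset s <= L2}.
  move=> sL /hasPn nL t st; have := sL t st; rewrite mem_cat => /orP[Lt|//].
  by have := nL t st; rewrite /= Lt.
(* On [U2], where [g] covers the open sets of [S]. *)
have [beta hbeta dbeta] : exists2 b, is_cochain h (fun s => ~~ has (mem S) s) (S ++ g) [::] 1 M b &
    forall s, {subset s <= S ++ g} -> coboundary b s = eta s.
  apply: (exact_relative h_neq0) => [s u us|x s gx|s sS /negPn/hasP[t st St]|s sL|s sL].
  - by apply: contraNN; apply: sub_has.
  - by rewrite /= negb_or => ->; rewrite andbT; apply: contraL gx; apply: Sg.
  - exact: (radical_seq_prod st (rad_S St)).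
  - split; [exact: eta_regular | | exact: eta_size].
    by move=> /(no_has _ _ _ sL); apply: eta_g.
  - exact: eta_cocycle.
(* On the intersection the zero primitive of [eta] over [U1] is subtracted from
   [beta]; [beta1] is [beta] corrected so as to agree with it. *)
have subS s : {subset s <= S} -> {subset s <= S ++ g}.
  by move=> sS t /sS; rewrite mem_cat => ->.
have [gam hgam dgam] : exists2 b, is_cochain h pred0 S [::] 1 M.-1 b &
    forall s, {subset s <= S} -> coboundary b s = beta s.
  apply: exact_of_size => // [s sS|s sS].
    have [r _ k0] := hbeta s (subS s sS); split=> // ks; apply: k0 => E.
    by apply: ks; rewrite -E.
  by rewrite (dbeta _ (subS s sS)); apply: eta_fS => t /sS; rewrite mem_cat => ->; rewrite orbT.
have [rgam kgam] := restriction_cochain hgam.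
pose beta1 s := beta s - coboundary (restriction S gam) s.
have hbeta1 : is_cochain h pred0 (S ++ g) [::] 1 M beta1.
  move=> s sL; have [r _ k0] := hbeta s sL; split=> // [|ks].
    by apply: regularB => //; apply: coboundary_regular.
  rewrite /beta1 k0 // (coboundary_size kgam) ?subrr // => E.
  by apply: ks; rewrite E add1n prednK //; case: (M) size_S.
have dbeta1 s : {subset s <= S ++ g} -> coboundary beta1 s = eta s.
  by move=> sL; rewrite /coboundary contractionB contraction_sqr subr0 [LHS]dbeta.
have beta1S s : {subset s <= S} -> beta1 s = 0.
  by move=> sS; rewrite /beta1 /coboundary contraction_restriction // [contraction _ _ _]dgam // subrr.
have [rbeta2 kbeta2] := restriction_cochain hbeta1.
set beta2 := restriction _ _ in rbeta2 kbeta2.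
pose eta1 s := eta s - coboundary beta2 s.
have deta1 s : coboundary eta1 s = 0.
  by rewrite /coboundary contractionB contraction_sqr subr0 [LHS]eta_cocycle.
have reta1 s : regular h s (eta1 s) by apply: regularB => //; apply: coboundary_regular.
have keta1 s : size s <> M -> eta1 s = 0.
  by move=> ks; rewrite /eta1 eta_size // (coboundary_size kbeta2) ?subrr.
have eta1_Sg s : {subset s <= S ++ g} -> eta1 s = 0.
  by move=> sL; rewrite /eta1 /coboundary contraction_restriction // [contraction _ _ _]dbeta1 // subrr.
have eta1_fS s : {subset s <= f ++ S} -> eta1 s = 0.
  move=> sL; rewrite /eta1 eta_fS // [coboundary _ _]contraction0 ?subrr // => u us _.
  rewrite /beta2 /restriction; case: allP => // uSg; apply: beta1S => t ut.
  have : t \in S ++ g := uSg t ut; rewrite mem_cat => /orP[//|gt].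
  have := sL t (mem_subseq us ut); rewrite mem_cat => /orP[ft|//].
  by have := fg ft; rewrite gt.
(* What remains is supported on sequences with letters of [f] and of [g], whose
   open sets lie in the intersection and are covered by [S]. *)
have [om hom dom] : exists2 b,
    is_cochain h (fun s => ~~ (has (mem f) s && has (mem g) s)) ((f ++ g) ++ S) [::] 1 M b &
    forall s, {subset s <= (f ++ g) ++ S} -> coboundary b s = eta1 s.
  apply: (exact_relative h_neq0) => [s u us|x s Sx|s sL|s sL|s sL].
  - by apply: contraNN => /andP[fu gu]; apply/andP; split; apply: (sub_has _ u).
  - apply: contraNN; rewrite /= => /andP[/orP[fx|fs] /orP[gx|gs]]; last by rewrite fs.
    + by have := Sf Sx; rewrite fx.
    + by have := Sf Sx; rewrite fx.
    + by have := Sg Sx; rewrite gx.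
  - move=> /negPn/andP[/hasP[t st ft] /hasP[u su gu]].
    apply: (radical_seq_prod2 _ st su (rad_fg ft gu)).
    by apply: contraTneq gu => <-; apply: fg.
  - split; [exact: reta1 | | exact: keta1]; rewrite /= negb_and => /orP[nf|ng].
      have sgS : {subset s <= g ++ S} by apply: (no_has f) => //; rewrite catA.
      by apply: eta1_Sg => t /sgS; rewrite !mem_cat orbC.
    apply: eta1_fS; apply: (no_has g _ _ _ ng) => t /sL.
    by rewrite !mem_cat -orbA orbCA.
  - exact: deta1.
have [|rom2 kom2] := @restriction_cochain (f ++ g) om M.
  move=> s sL; have [|r _ k0] := hom s _; last by split.
  by move=> t /sL fgt; rewrite mem_cat fgt.
set om2 := restriction _ _ in rom2 kom2.
pose eta2 s := eta1 s - coboundary om2 s.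
(* From the cover by [f] and [g] to the cover by [z] of the same open set. *)
have [th hth dth] : exists2 b, is_cochain h (fun s => ~~ has (mem z) s) (z ++ (f ++ g)) [::] 1 M b &
    forall s, {subset s <= z ++ (f ++ g)} -> coboundary b s = eta2 s.
  apply: (exact_relative h_neq0) => [s u us|x s fgx|s sL /negPn/hasP[t st zt]|s sL|s sL].
  - by apply: contraNN; apply: sub_has.
  - rewrite /= negb_or => ->; rewrite andbT; apply: contraL fgx => zx.
    by rewrite mem_cat negb_or zf ?zg.
  - exact: (radical_seq_prod st (rad_z zt)).
  - split.
    + by apply: regularB => //; apply: coboundary_regular.
    + move=> nz; have sfg := no_has _ _ _ sL nz.
      rewrite /eta2 /coboundary contraction_restriction // [contraction _ _ _]dom ?subrr //.
      by move=> t /sfg; rewrite [in X in _ -> X]mem_cat => ->.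
    + by move=> ks; rewrite /eta2 keta1 // (coboundary_size kom2) // subrr.
  - by rewrite /coboundary contractionB contraction_sqr subr0 [LHS]deta1.
have [rth _] := restriction_cochain (cochain_pred0 hth).
exists (fun s => restriction (z ++ (f ++ g)) th s + (om2 s + beta2 s)).
  by move=> s; apply: regularD => //; apply: regularD.
move=> s sz; have sL : {subset s <= z ++ (f ++ g)}.
  by move=> t /sz; rewrite mem_cat => ->.
rewrite /coboundary !contractionD contraction_restriction // [X in X + _]dth //.
by rewrite addrA /eta2 /eta1 /coboundary !subrK.
Qed.

End MayerVietoris.

(** * The Koszul class and its residue *)

Section KoszulClass.
Local Open Scope ring_scope.
Variables (Q : comNzRingType) (T : eqType) (I : eqType) (v : I -> T -> Q).
Implicit Types (r : seq I) (s : seq T).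

(** The Koszul class of the functions [a i] such that [a i * v i] is a partition
    of unity: up to sign, 1 over the product of the [a i], extended to any cover
    on which they have no common zero. *)
Definition koszul r : seq T -> Q :=
  foldr (fun i c => contraction (v i) c) (fun s => (nilp s)%:R) r.

Lemma koszul_size r s : size s <> size r -> koszul r s = 0.
Proof.
elim: r s => [|i r IHr] s /=; first by rewrite /nilp; case: (size s).
move=> ne; apply: contraction0 => u _ Es; apply: IHr => Eu.
by apply: ne; rewrite Es Eu.
Qed.

Lemma koszul_vanish (L : pred T) r i s :
  i \in r -> {in L, forall t, v i t = 0} -> {subset s <= L} -> koszul r s = 0.
Proof.
move=> ri v0; elim: r ri s => [|j r IHr] //=.
rewrite inE => /predU1P[<-|ri] s sL; first by apply: contraction0l => t /sL /v0.
by apply: contraction0 => u us _; apply: IHr => // t /(mem_subseq us)/sL.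
Qed.

Lemma koszul_kill r i s : i \in r -> contraction (v i) (koszul r) s = 0.
Proof.
elim: r s => [|j r IHr] s //=; rewrite inE => /predU1P[->|ri].
  exact: contraction_sqr.
by rewrite contraction_anticomm contraction0 ?oppr0 // => u _ _; apply: IHr.
Qed.

Lemma contraction_suml r (a : I -> Q) c s :
  contraction (fun t => \sum_(i <- r) a i * v i t) c s
  = \sum_(i <- r) a i * contraction (v i) c s.
Proof.
elim: r => [|i r IHr].
  by rewrite big_nil contraction0l // => t _; rewrite big_nil.
rewrite big_cons -IHr -contraction_linl; apply: eq_contractionl => t _.
by rewrite big_cons.
Qed.

(** The coboundary is a combination of the contractions by the [v i], each of
    which already occurs in the class. *)
Lemma koszul_cocycle r (a : I -> Q) s :
  (forall t, \sum_(i <- r) a i * v i t = 1) -> coboundary (koszul r) s = 0.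
Proof.
move=> sum1.
have -> : coboundary (koszul r) s
    = contraction (fun t => \sum_(i <- r) a i * v i t) (koszul r) s.
  by apply: eq_contractionl => t _; rewrite sum1.
rewrite contraction_suml big_seq big1 // => i ri.
by rewrite koszul_kill ?mulr0.
Qed.

(** Two weights supported on the letters [x] and [y] contribute a two by two
    determinant. *)
Lemma contraction_pair (w w' : T -> Q) c x y s :
    {in s, forall t, w t = 0} -> {in s, forall t, w' t = 0} ->
  contraction w (contraction w' c) [:: x, y & s] = (w x * w' y - w y * w' x) * c s.
Proof.
move=> w0 w0' /=; rewrite !(contraction0l _ w0) !(contraction0l _ w0').
by rewrite !subr0 !mulrA mulrBl.
Qed.

End KoszulClass.

Section Residue.
Local Open Scope ring_scope.
Variables (K : fieldType) (n : nat) (T : finType) (h : T -> {mpoly K[n]}).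
Variables (z : 'I_n -> T) (hz : forall i, h (z i) = 'X_i).
Local Notation A := ({mpoly K[n]} : idomainType).
Local Notation "x %:F" := (@tofrac A x).
Variables (r : seq 'I_n) (r_perm : perm_eq r (enum 'I_n)).
Variables (e : 'X_{1..n}) (e_gt0 : forall i, (0 < e i)%N).

Definition all_ones : 'X_{1..n} := [multinom 1%N | i < n].

Lemma mcoeffMXn (b : A) j N (m : 'X_{1..n}) : (m j < N)%N -> (b * 'X_j ^+ N)@_m = 0.
Proof.
move=> ltmN; elim/mpolyind: b => [|c m' b _ _ IHb]; first by rewrite mul0r mcoeff0.
rewrite mulrDl mcoeffD IHb addr0 -scalerAl mcoeffZ mpolyXn -mpolyXD mcoeffX.
case: eqP => [E|]; last by rewrite mulr0.
by move: ltmN; rewrite -E mnmDE mulmnE mnm1E eqxx mul1n ltnNge leq_addl.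
Qed.

Lemma seq_prod_z : seq_prod h [seq z i | i <- r] = 'X_[all_ones].
Proof.
rewrite /seq_prod big_map (perm_big _ r_perm) /= big_enum /= mpolyXE_id.
by apply: eq_bigr => i _; rewrite hz mnmE expr1.
Qed.

(** The coefficient of the monomial [- e] of a Laurent polynomial is zero.  The
    numerator is taken over a common power of the variables, which must be high
    enough for the subtraction of exponents not to be truncated. *)
Definition no_residue (q : {fraction A}) : Prop :=
  exists N a, [/\ forall i, (e i <= N)%N, q * ('X_[all_ones] ^+ N)%:F = a%:F
    & a@_(all_ones *+ N - e)%MM = 0].

Lemma no_residue_shift q N N' a : (N <= N')%N -> (forall i, (e i <= N)%N) ->
    q * ('X_[all_ones] ^+ N)%:F = a%:F -> a@_(all_ones *+ N - e)%MM = 0 ->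
  exists a', q * ('X_[all_ones] ^+ N')%:F = a'%:F /\ a'@_(all_ones *+ N' - e)%MM = 0.
Proof.
move=> leN eN Eq a0; exists (a * 'X_[all_ones *+ (N' - N)%N]); split.
  by rewrite -[in LHS](subnKC leN) exprD !rmorphM mulrA Eq mpolyXn.
rewrite -[RHS]a0 -[RHS](mcoeffMX _ (all_ones *+ (N' - N)%N)%MM).
congr (_@__); apply/mnmP => i; rewrite !(mnmBE, mnmDE, mulmnE) mnmE !mul1n.
by rewrite addnBA // subnK.
Qed.

Lemma no_residueB q q' : no_residue q -> no_residue q' -> no_residue (q - q').
Proof.
case=> N [a [eN Eq a0]] [N' [a' [eN' Eq' a0']]].
have [b [Eb b0]] := no_residue_shift (leq_maxl N N') eN Eq a0.
have [b' [Eb' b0']] := no_residue_shift (leq_maxr N N') eN' Eq' a0'.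
exists (maxn N N'), (b - b'); split=> [i||]; first by rewrite leq_max eN.
  by rewrite mulrBl Eb Eb' rmorphB.
by rewrite mcoeffB b0 b0' subrr.
Qed.

(** The sequence [u] omits a variable; so does the denominator of [q], whereas
    every exponent of [e] is positive. *)
Lemma no_residue_face u q :
    subseq u [seq z i | i <- r] -> size [seq z i | i <- r] = (size u).+1 ->
  regular h u q -> no_residue q.
Proof.
set s := [seq z i | i <- r] => us Es [k [a Eq]].
have uniq_s : uniq s.
  rewrite map_inj_uniq ?(perm_uniq r_perm) ?enum_uniq // => i j Eij.
  have : ('X_i : A)@_U_(i) = ('X_j : A)@_U_(i) by rewrite -!hz Eij.
  rewrite !mcoeffXU eqxx; case: eqP => // _ /eqP.
  by rewrite oner_eq0.
have [t st nut] : exists2 t, t \in s & t \notin u.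
  apply/hasP; rewrite has_predC; apply/negP => /allP su.
  by have := uniq_leq_size uniq_s su; rewrite Es ltnn.
have Ptu : perm_eq s (t :: u).
  have uniq_tu : uniq (t :: u) by rewrite /= nut (subseq_uniq us).
  have sub_tu : {subset t :: u <= s}.
    by move=> x; rewrite inE => /predU1P[->//|/(mem_subseq us)].
  have [|_ E] := uniq_min_size uniq_tu sub_tu; first by rewrite Es.
  by apply: uniq_perm => // x; rewrite E.
have [j _ tj] := mapP st.
have Eones : 'X_[all_ones] = seq_prod h u * 'X_j.
  by rewrite -seq_prod_z -/s /seq_prod (perm_big _ Ptu) big_cons tj hz mulrC.
pose N := (k + \max_i e i)%N.
have eN i : (e i <= N)%N by rewrite /N (leq_trans (leq_bigmax i)) ?leq_addl.
exists N, (a * seq_prod h u ^+ (\max_i e i) * 'X_j ^+ N); split=> //.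
  by rewrite Eones exprMn {1}/N exprD !rmorphM !mulrA Eq.
apply: mcoeffMXn; rewrite mnmBE mulmnE mnmE mul1n ltn_subrL e_gt0.
by rewrite (leq_trans (e_gt0 j)).
Qed.

(** A coboundary on the full sequence of variables is a sum of fractions each
    omitting a variable in its denominator, so it has no component
    [c / 'X_[e]]. *)
Lemma coboundary_residue (xi : seq T -> {fraction A}) c :
    (forall s, regular h s (xi s)) ->
    coboundary xi [seq z i | i <- r] * ('X_[e])%:F = (c%:MP)%:F ->
  c = 0.
Proof.
move=> rxi; set q := coboundary xi _ => Eq.
have [N [a [eN Ea a0]]] : no_residue q.
  apply: contraction_closed => [||t q' _|u us Es].
  - exists (\max_i e i), 0; split=> [i||]; first exact: leq_bigmax.
    + by rewrite mul0r rmorph0.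
    + by rewrite mcoeff0.
  - exact: no_residueB.
  - by rewrite mul1r.
  - exact: no_residue_face us Es (rxi u).
have : a * 'X_[e] = c%:MP * 'X_[all_ones *+ N - e] * 'X_[e].
  apply/eqP; rewrite -tofrac_eq (tofracM a) -Ea mulrAC Eq -rmorphM mpolyXn -mulrA -mpolyXD.
  apply/eqP; congr (_ * _)%:F; congr 'X_[_]; apply/mnmP => i.
  by rewrite mnmDE mnmBE mulmnE mnmE mul1n subnK.
move/(mulIf _) => Ec; move: a0; rewrite Ec; last by rewrite -msupp_eq0 msuppX.
by rewrite mul_mpolyC mcoeffZ mcoeffX eqxx mulr1.
Qed.

End Residue.

(** * Finite unions of graphs through the origin *)

Section ZeroSets.
Local Open Scope ring_scope.
Variables (K : fieldType) (n : nat).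
Implicit Types (P : seq {mpoly K[n]}) (v : 'I_n -> K).

Definition zero_at v P := all (fun p : {mpoly K[n]} => p.@[v] == 0) P.

Lemma zero_at_prod v P P' :
  zero_at v [seq p * q | p <- P, q <- P'] = zero_at v P || zero_at v P'.
Proof.
rewrite /zero_at; elim: P => //= p P IHP; rewrite all_cat IHP all_map /preim /=.
have -> : all (fun q => (p * q).@[v] == 0) P' = (p.@[v] == 0) || all (fun q => q.@[v] == 0) P'.
  elim: (P') => [|q P'' IHP'] /=; first by rewrite orbT.
  by rewrite IHP' mevalM mulf_eq0 orb_andr.
by rewrite orb_andl.
Qed.

Lemma zero_at_filter v P : zero_at v [seq p <- P | p != 0] = zero_at v P.
Proof.
rewrite /zero_at; elim: P => //= p P IHP; case: eqVneq => [->|_] /=; last by rewrite IHP.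
by rewrite IHP meval0 eqxx.
Qed.

Lemma zero_at_nth v P k : zero_at v P -> (P`_k).@[v] = 0.
Proof.
move=> /allP Pv; have [lt_k|le_k] := ltnP k (size P); last by rewrite nth_default ?meval0.
exact/eqP/Pv/mem_nth.
Qed.

End ZeroSets.

(** The determinant of the weights of the two equations [y - c1 x] and
    [y - c2 x] on the letters [x] and [y], where [d] inverts [c2 - c1]. *)
Lemma pair_weights (F : fieldType) (c1 c2 x y d : F) :
    (x != 0 -> y != 0 -> d * (c2 - c1) = 1 ->
  (d / x * - (c1 * (d / y)) - c2 * (d / y) * - (d / x)) * (x * y) = d)%R.
Proof.
move=> x0 y0 hd; have Ex : (x^-1 * x = 1)%R by rewrite mulVf.
have Ey : (y^-1 * y = 1)%R by rewrite mulVf.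
move: (x^-1)%R (y^-1)%R Ex Ey => x' y' Ex Ey.
have -> : ((d * x' * - (c1 * (d * y')) - c2 * (d * y') * - (d * x')) * (x * y)
   = d * (d * (c2 - c1)) * (x' * x) * (y' * y))%R by ring.
by rewrite hd Ex Ey !mulr1.
Qed.

Section GraphUnion.
Local Open Scope ring_scope.
Variables (K : closedFieldType) (m : nat) (a : 'I_m -> nat).
Hypotheses (m_gt0 : (0 < m)%N) (a_gt0 : forall j, (0 < a j)%N).
Variables (zs : seq K) (z1 z2 : K).
Hypotheses (zs1 : z1 \in zs) (zs2 : z2 \in zs) (z12 : z2 != z1).
Local Notation A := ({mpoly K[m + m]} : idomainType).
Local Notation "x %:F" := (@tofrac A x).
Local Notation Q := {fraction A}.
Local Notation xi j := (lshift m j).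
Local Notation yi j := (rshift m j).

Definition graph_eq (z : K) j : {mpoly K[m + m]} := 'X_(yi j) - z *: 'X_(xi j) ^+ a j.
Definition graph z := [seq graph_eq z j | j <- enum 'I_m].
(** Products of one equation of each graph define the union; the empty union is
    defined by 1. *)
Definition graph_union (s : seq K) : seq {mpoly K[m + m]} :=
  foldr (fun z P => [seq p * q | p <- graph z, q <- P]) [:: 1] s.

Lemma graph_eqE z j v : (graph_eq z j).@[v] = v (yi j) - z * v (xi j) ^+ a j.
Proof. by rewrite mevalB mevalZ rmorphXn /= !mevalXU. Qed.

Lemma zero_at_graphP z v :
  reflect (forall j, v (yi j) = z * v (xi j) ^+ a j) (zero_at v (graph z)).
Proof.
apply: (iffP allP) => [h j|h _ /mapP[j _ ->]].
  have := h _ (map_f (graph_eq z) (mem_enum 'I_m j)).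
  by rewrite graph_eqE subr_eq0 => /eqP.
by rewrite graph_eqE h subrr.
Qed.

Lemma zero_at_graph_union v s : zero_at v (graph_union s) = has (fun z => zero_at v (graph z)) s.
Proof.
elim: s => [|z s IHs] /=; first by rewrite /zero_at /= meval1 oner_eq0.
by rewrite zero_at_prod IHs.
Qed.

Variable Fs : seq {mpoly K[m + m]}.
Hypothesis FsE : forall v, zero_at v Fs = has (fun z => zero_at v (graph z)) zs.

Let G : seq {mpoly K[m + m]} := [seq p <- graph_union [seq z <- zs | z != z1] | p != 0].
Let S : seq {mpoly K[m + m]} := [seq p <- Fs | p != 0].

Lemma zero_at_G v : zero_at v G = has (fun z => zero_at v (graph z)) [seq z <- zs | z != z1].
Proof. by rewrite zero_at_filter zero_at_graph_union. Qed.

Lemma zero_at_S v : zero_at v S = has (fun z => zero_at v (graph z)) zs.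
Proof. by rewrite zero_at_filter FsE. Qed.

(** The four covers: equations of the graph of [z1], equations of the other
    graphs, the given equations of the union, and the coordinates. *)
Definition letter : finType := (('I_m + 'I_(size G)) + ('I_(size S) + 'I_(m + m)))%type.

Definition letter_eq (t : letter) : {mpoly K[m + m]} :=
  match t with
  | inl (inl j) => graph_eq z1 j
  | inl (inr k) => G`_k
  | inr (inl k) => S`_k
  | inr (inr i) => 'X_i
  end.

Definition f_letters : seq letter := [seq inl (inl j) | j <- enum 'I_m].
Definition g_letters : seq letter := [seq inl (inr k) | k <- enum 'I_(size G)].
Definition S_letters : seq letter := [seq inr (inl k) | k <- enum 'I_(size S)].
Definition z_letters : seq letter := [seq inr (inr i) | i <- enum 'I_(m + m)].

Lemma map_nth_enum (P : seq {mpoly K[m + m]}) : [seq P`_(val k) | k <- enum 'I_(size P)] = P.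
Proof.
by rewrite -[RHS](mkseq_nth 0) /mkseq -val_enum_ord -map_comp.
Qed.

Lemma map_f_letters : [seq letter_eq t | t <- f_letters] = graph z1.
Proof. by rewrite -map_comp. Qed.
Lemma map_g_letters : [seq letter_eq t | t <- g_letters] = G.
Proof. by rewrite -map_comp -[RHS]map_nth_enum; apply: eq_map. Qed.
Lemma map_S_letters : [seq letter_eq t | t <- S_letters] = S.
Proof. by rewrite -map_comp -[RHS]map_nth_enum; apply: eq_map. Qed.

Lemma mpolyX_neq0 n (i : 'I_n) : ('X_i : {mpoly K[n]}) != 0.
Proof. by rewrite -msupp_eq0 msuppX. Qed.

Lemma letter_neq0 t : letter_eq t != 0.
Proof.
have nz P (k : 'I_(size [seq p <- P | p != 0])) : ([seq p <- P | p != 0])`_k != 0 :> {mpoly K[m + m]}.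
  by have := mem_nth 0 (ltn_ord k); rewrite mem_filter => /andP[].
case: t => [[j|k]|[k|i]] /=; [|exact: nz|exact: nz|exact: mpolyX_neq0].
(* The equation takes the value 1 at the point where [y_j] is 1 and the other
   coordinates are 0. *)
apply/eqP => /(congr1 (meval (fun i => (i == yi j)%:R))).
rewrite graph_eqE meval0 eqxx eq_lrshift expr0n gtn_eqF //= mulr0 subr0 => /eqP.
by rewrite oner_eq0.
Qed.

Lemma radical_zero_at (P : seq {mpoly K[m + m]}) p :
  (forall v, zero_at v P -> p.@[v] = 0) -> radical P p.
Proof.
move=> hp; apply: nullstellensatz => v Pv; apply: hp.
by apply/allP => q /Pv/eqP.
Qed.

(** The origin is cut out by the equations of two of the graphs. *)
Definition pair_eq (i : 'I_m + 'I_m) : {mpoly K[m + m]} :=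
  match i with inl j => graph_eq z1 j | inr j => graph_eq z2 j end.

Definition pair_seq (js : seq 'I_m) : seq ('I_m + 'I_m) := flatten [seq [:: inl j; inr j] | j <- js].
Definition coord_seq (js : seq 'I_m) : seq 'I_(m + m) := flatten [seq [:: xi j; yi j] | j <- js].

Lemma big_pair_seq (R : nmodType) js (F : 'I_m + 'I_m -> R) :
  \sum_(i <- pair_seq js) F i = \sum_(j <- js) (F (inl j) + F (inr j)).
Proof. by elim: js => [|j js IHjs]; rewrite ?big_nil // !big_cons IHjs addrA. Qed.

Definition inv_diff : Q := ((z2 - z1)%:MP)%:F^-1.
Definition xa j : Q := ('X_(xi j) ^+ a j)%:F.
Definition yv j : Q := ('X_(yi j))%:F.

(** Weights expressing the letter [t] through the equations of the graphs of
    [z1] and [z2].  On [U1], and on its intersection with [U2], the equations of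
    the first graph are enough; on [U2] those of the second are.  On the
    coordinates the weights solve
    [x ^ a = (f - g) / (z2 - z1)] and [y = (z2 f - z1 g) / (z2 - z1)], where
    [f = y - z1 x ^ a] and [g = y - z2 x ^ a]. *)
Definition weight_spec (t : letter) (w : 'I_m + 'I_m -> Q) : Prop :=
  match t with
  | inl (inl _) | inr (inl _) => forall j, w (inr j) = 0
  | inl (inr _) => forall j, w (inl j) = 0
  | inr (inr i) =>
      (forall j, i = xi j -> forall j', w (inl j') = (j' == j)%:R * (inv_diff / xa j)
                                   /\ w (inr j') = (j' == j)%:R * - (inv_diff / xa j))
   /\ (forall j, i = yi j -> forall j', w (inl j') = (j' == j)%:R * ((z2%:MP)%:F * (inv_diff / yv j))
                             /\ w (inr j') = (j' == j)%:R * - ((z1%:MP)%:F * (inv_diff / yv j)))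
  end.

Lemma regular1 (t : letter) n (b : A) : regular letter_eq [:: t] (b%:F / (letter_eq t ^+ n)%:F).
Proof.
exists n, b; rewrite /seq_prod big_seq1 mulfVK // tofrac_eq0 expf_neq0 //.
exact: letter_neq0.
Qed.

Lemma xa_neq0 j : xa j != 0.
Proof. by rewrite tofrac_eq0 expf_neq0 // mpolyX_neq0. Qed.
Lemma yv_neq0 j : yv j != 0.
Proof. by rewrite tofrac_eq0 mpolyX_neq0. Qed.
Lemma z21_neq0 : ((z2 - z1)%:MP)%:F != 0.
Proof. by rewrite tofrac_eq0 mpolyC_eq0 subr_eq0. Qed.

Lemma radical_weights (t : letter) z : radical (graph z) (letter_eq t) ->
  exists w : 'I_m -> Q, \sum_j (graph_eq z j)%:F * w j = 1 /\ forall j, regular letter_eq [:: t] (w j).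
Proof.
case=> n /generated_lincomb[u En]; exists (fun j => (u j)%:F / (letter_eq t ^+ n)%:F).
split=> [|j]; last exact: regular1.
have nz : (letter_eq t ^+ n)%:F != 0 by rewrite tofrac_eq0 expf_neq0 // letter_neq0.
apply: (mulIf nz); rewrite mul1r mulr_suml [in RHS]En rmorph_sum /=.
by apply: eq_bigr => j _; rewrite mulrA mulfVK // -rmorphM mulrC.
Qed.

Lemma weight_exists t : exists w : 'I_m + 'I_m -> Q,
  [/\ \sum_(i <- pair_seq (enum 'I_m)) (pair_eq i)%:F * w i = 1,
      forall i, regular letter_eq [:: t] (w i) & weight_spec t w].
Proof.
have left : radical (graph z1) (letter_eq t) -> (forall w : 'I_m + 'I_m -> Q,
    (forall j, w (inr j) = 0) -> weight_spec t w) -> exists w : 'I_m + 'I_m -> Q,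
  [/\ \sum_(i <- pair_seq (enum 'I_m)) (pair_eq i)%:F * w i = 1,
      forall i, regular letter_eq [:: t] (w i) & weight_spec t w].
  case/radical_weights=> w [sw rw] spec.
  exists (fun i => if i is inl j then w j else 0); split; last exact: spec.
    rewrite big_pair_seq -[RHS]sw big_enum /=; apply: eq_bigr => j _.
    by rewrite mulr0 addr0.
  by case=> j //; apply: regular0.
have right : radical (graph z2) (letter_eq t) -> (forall w : 'I_m + 'I_m -> Q,
    (forall j, w (inl j) = 0) -> weight_spec t w) -> exists w : 'I_m + 'I_m -> Q,
  [/\ \sum_(i <- pair_seq (enum 'I_m)) (pair_eq i)%:F * w i = 1,
      forall i, regular letter_eq [:: t] (w i) & weight_spec t w].
  case/radical_weights=> w [sw rw] spec.
  exists (fun i => if i is inr j then w j else 0); split; last exact: spec.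
    rewrite big_pair_seq -[RHS]sw big_enum /=; apply: eq_bigr => j _.
    by rewrite mulr0 add0r.
  by case=> j //; apply: regular0.
case: t left right => [[j|k]|[k|i]] left right.
- by apply: left => //; apply: mem_radical; apply: map_f; rewrite mem_enum.
- apply: right => //; apply: radical_zero_at => v gv; apply: zero_at_nth.
  by rewrite zero_at_G; apply/hasP; exists z2 => //; rewrite mem_filter z12.
- apply: left => //; apply: radical_zero_at => v fv; apply: zero_at_nth.
  by rewrite zero_at_S; apply/hasP; exists z1.
have sum1 j (w : 'I_m + 'I_m -> Q) c d :
    (graph_eq z1 j)%:F * c + (graph_eq z2 j)%:F * d = 1 ->
    (forall j', w (inl j') = (j' == j)%:R * c) -> (forall j', w (inr j') = (j' == j)%:R * d) ->
  \sum_(i <- pair_seq (enum 'I_m)) (pair_eq i)%:F * w i = 1.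
  move=> sum1 wl wr; rewrite big_pair_seq big_enum /= (bigD1 j) //= wl wr eqxx !mul1r sum1.
  rewrite big1 ?addr0 // => j' /negPf ne.
  by rewrite wl wr ne !mul0r !mulr0 addr0.
have graphF z j : (graph_eq z j)%:F = yv j - (z%:MP)%:F * xa j.
  by rewrite rmorphB -mul_mpolyC rmorphM.
have E21 : (z2%:MP)%:F - (z1%:MP)%:F = ((z2 - z1)%:MP)%:F by rewrite -rmorphB -mpolyCB.
have rb (b : bool) s q : regular letter_eq s q -> regular letter_eq s (b%:R * q).
  by case: b => rq; rewrite ?mul1r // mul0r; apply: regular0.
have rN s q : regular letter_eq s q -> regular letter_eq s (- q).
  by move=> rq; rewrite -sub0r; apply: regularB => //; apply: regular0.
have rdelta s : regular letter_eq s inv_diff.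
  have -> : inv_diff = ((z2 - z1)^-1%:MP)%:F.
    apply: (mulfI z21_neq0); rewrite divff ?z21_neq0 // -rmorphM -mpolyCM.
    by rewrite divff ?subr_eq0 // mpolyC1 rmorph1.
  exact: regularA.
case: (split_ordP i) => j Ei {left right}.
- have rq : regular letter_eq [:: inr (inr i)] (inv_diff / xa j).
    apply: regularM => //; rewrite -[_^-1]mul1r -(rmorph1 (@tofrac A)) /xa -Ei.
    exact: (@regular1 (inr (inr i))).
  exists (fun i => match i with inl j' => (j' == j)%:R * (inv_diff / xa j)
                           | inr j' => (j' == j)%:R * - (inv_diff / xa j) end).
  split.
  + apply: (sum1 j (fun _ => _) (inv_diff / xa j) (- (inv_diff / xa j))) => //.
    rewrite mulrN -mulrBl !graphF opprB addrC addrA subrK -mulrBl E21.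
    by rewrite mulrACA divff ?z21_neq0 // divff ?xa_neq0 // mulr1.
  + by case=> j'; apply: rb => //; apply: rN.
  + split=> j' Ei' j''; first by rewrite (lshift_inj (etrans (esym Ei) Ei')).
    by move: Ei; rewrite Ei' => /eqP; rewrite eq_rlshift.
- have rq : regular letter_eq [:: inr (inr i)] (inv_diff / yv j).
    apply: regularM => //; rewrite -[_^-1]mul1r -(rmorph1 (@tofrac A)) /yv -Ei -[X in X%:F^-1]expr1.
    exact: (@regular1 (inr (inr i))).
  exists (fun i => match i with inl j' => (j' == j)%:R * ((z2%:MP)%:F * (inv_diff / yv j))
                           | inr j' => (j' == j)%:R * - ((z1%:MP)%:F * (inv_diff / yv j)) end).
  split.
  + apply: (sum1 j (fun _ => _) ((z2%:MP)%:F * (inv_diff / yv j)) (- ((z1%:MP)%:F * (inv_diff / yv j)))) => //.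
    rewrite mulrN !mulrA -!mulrBl !graphF.
    have -> : (yv j - (z1%:MP)%:F * xa j) * (z2%:MP)%:F - (yv j - (z2%:MP)%:F * xa j) * (z1%:MP)%:F
           = ((z2 - z1)%:MP)%:F * yv j.
      by rewrite -E21; ring.
    by rewrite mulrAC mulfK ?yv_neq0 // divff ?z21_neq0.
  + case=> j'; apply: rb; [|apply: rN]; by apply: regularM => //; apply: regularA.
  + split=> j' Ei' j''; last by rewrite (rshift_inj (etrans (esym Ei) Ei')).
    by move: Ei; rewrite Ei' => /eqP; rewrite eq_lrshift.
Qed.



Lemma mem_pair_seq js i : (i \in pair_seq js) = match i with inl j | inr j => j \in js end.
Proof.
elim: js => [|j js IHjs] /=; first by case: i.
by case: i IHjs => j' IHjs; rewrite !inE IHjs //= orbF.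
Qed.

Lemma size_pair_seq js : size (pair_seq js) = (size js + size js)%N.
Proof. by elim: js => //= j js ->; rewrite addnS. Qed.

Lemma size_coord_seq js : size (coord_seq js) = (size js + size js)%N.
Proof. by elim: js => //= j js ->; rewrite addnS. Qed.

Lemma mem_coord_seq js j : j \in js -> (xi j \in coord_seq js) && (yi j \in coord_seq js).
Proof.
elim: js => //= j' js IHjs; rewrite !inE => /predU1P[->|/IHjs/andP[-> ->]].
  by rewrite !eqxx !orbT.
by rewrite !orbT.
Qed.

Lemma mem_coord_seqP js i : i \in coord_seq js -> exists2 j, j \in js & i = xi j \/ i = yi j.
Proof.
elim: js => //= j js IHjs; rewrite !inE => /or3P[/eqP->|/eqP->|/IHjs[j' js_j' Ei]].
- by exists j; [exact: mem_head | left].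
- by exists j; [exact: mem_head | right].
- by exists j'; rewrite ?inE ?js_j' ?orbT.
Qed.

Lemma coord_seq_perm : perm_eq (coord_seq (enum 'I_m)) (enum 'I_(m + m)).
Proof.
have sub : {subset enum 'I_(m + m) <= coord_seq (enum 'I_m)}.
  move=> i _; case: (split_ordP i) => j ->.
    by have /andP[] := mem_coord_seq (mem_enum 'I_m j).
  by have /andP[] := mem_coord_seq (mem_enum 'I_m j).
have le : (size (coord_seq (enum 'I_m)) <= size (enum 'I_(m + m)))%N.
  by rewrite size_coord_seq !size_enum_ord.
have [_ E] := uniq_min_size (enum_uniq 'I_(m + m)) sub le.
apply: uniq_perm => [||i]; last by rewrite E.
- exact: leq_size_uniq (enum_uniq 'I_(m + m)) sub le.
- exact: enum_uniq.
Qed.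

Lemma xa_yvE : \prod_(j < m) (xa j * yv j)
  = ('X_[[multinom match split i with inl j => a j | inr _ => 1%N end | i < m + m]])%:F.
Proof.
rewrite mpolyXE_id rmorph_prod /= big_split_ord /= big_split /=.
congr (_ * _); apply: eq_bigr => j _; rewrite mnmE.
  by rewrite (unsplitK (inl _ j)).
by rewrite (unsplitK (inr _ j)) expr1.
Qed.

(** If the union of the graphs had fewer equations, [mayer_vietoris] would make
    the Koszul class of the origin a coboundary on the coordinate letters, where
    its value is a nonzero constant over a monomial that involves all the
    variables. *)
Theorem graph_union_size : ((m + m).-1 <= size Fs)%N.
Proof.
rewrite leqNgt; apply/negP => ltF.
have [W HW] := fin_all_exists weight_exists.
pose v i t := W t i; pose r := pair_seq (enum 'I_m); pose eta := koszul v r.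
have sumW t : \sum_(i <- r) (pair_eq i)%:F * v i t = 1 by have [] := HW t.
have regW i t : regular letter_eq [:: t] (v i t) by have [_ rw _] := HW t; apply: rw.
have specW t : weight_spec t (v^~ t) by have [] := HW t.
have sizeS : (size S_letters < (m + m).-1)%N.
  rewrite size_map size_enum_ord (leq_ltn_trans _ ltF) // size_filter.
  exact: count_size.
have [j0 _] : exists j0 : 'I_m, True by exists (Ordinal m_gt0).
have zG z : z \in zs -> z != z1 -> forall v0, zero_at v0 (graph z) -> zero_at v0 G.
  by move=> zsz ne v0 gz; rewrite zero_at_G; apply/hasP; exists z => //; rewrite mem_filter ne.
have zS z : z \in zs -> forall v0, zero_at v0 (graph z) -> zero_at v0 S.
  by move=> zsz v0 gz; rewrite zero_at_S; apply/hasP; exists z.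
have [||||||||||||||b rb db] := @mayer_vietoris A letter letter_eq letter_neq0 f_letters g_letters
    S_letters z_letters (m + m) eta.
- by move=> _ /mapP[k _ ->]; apply/mapP => -[j _].
- by move=> _ /mapP[k _ ->]; apply/mapP => -[j _].
- by move=> _ /mapP[k _ ->]; apply/mapP => -[j _].
- by move=> _ /mapP[k _ ->]; apply/mapP => -[j _].
- by move=> _ /mapP[k _ ->]; apply/mapP => -[j _].
- exact: sizeS.
- move=> _ /mapP[k _ ->]; rewrite map_g_letters; apply: radical_zero_at => u.
  rewrite zero_at_G => /hasP[z]; rewrite mem_filter => /andP[_ zsz] gz.
  exact/zero_at_nth/(zS z).
- move=> _ _ /mapP[j _ ->] /mapP[k _ ->]; rewrite map_S_letters; apply: radical_zero_at => u.
  rewrite zero_at_S mevalM => /hasP[z zsz gz].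
  have [z_1|ne] := eqVneq z z1.
    by rewrite /letter_eq graph_eqE (zero_at_graphP _ _ gz) z_1 subrr mul0r.
  by rewrite [X in _ * X]zero_at_nth ?mulr0 //; apply: zG gz.
- move=> _ /mapP[i _ ->]; rewrite map_cat map_f_letters map_g_letters; apply: radical_zero_at => u.
  rewrite /zero_at all_cat => /andP[g1]; rewrite -/(zero_at u G) zero_at_G => /hasP[z].
  rewrite mem_filter => /andP[ne _] /zero_at_graphP gz.
  have x0 j : u (xi j) ^+ a j = 0.
    have : (z - z1) * u (xi j) ^+ a j = 0.
      by rewrite mulrBl -gz -(zero_at_graphP _ _ g1) subrr.
    by move/eqP; rewrite mulf_eq0 subr_eq0 (negPf ne) => /eqP.
  rewrite /= mevalXU; case: (split_ordP i) => j ->; last by rewrite gz x0 mulr0.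
  by move/eqP: (x0 j); rewrite expf_eq0 => /andP[_ /eqP].
- rewrite /eta; elim: (r) => [|i r' IHr] s /=.
    case: nilp; first by rewrite -(rmorph1 (@tofrac A)); apply: regularA.
    exact: regular0.
  by apply: contraction_regular => // t _; apply: regW.
- by move=> s ns; apply: koszul_size; rewrite size_pair_seq size_enum_ord.
- by move=> s; apply: koszul_cocycle sumW.
- move=> s; apply: (@koszul_vanish _ _ _ v (mem (f_letters ++ S_letters)) r (inr j0)).
    by rewrite mem_pair_seq mem_enum.
  move=> t; rewrite inE /= mem_cat => /orP[] /mapP[k _ ->].
    exact: (specW (inl (inl k))).
  exact: (specW (inr (inl k))).
- move=> s; apply: (@koszul_vanish _ _ _ v (mem g_letters) r (inl j0)).
    by rewrite mem_pair_seq mem_enum.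
  by move=> t /mapP[k _ ->]; apply: (specW (inl (inr k))).
have eval js : uniq js ->
    koszul v (pair_seq js) [seq inr (inr i) | i <- coord_seq js] * \prod_(j <- js) (xa j * yv j)
    = \prod_(j <- js) inv_diff.
  elim: js => [|j js IHjs]; first by rewrite !big_nil mulr1.
  case/andP=> njs uniq_js.
  have zero i : i \in coord_seq js -> v (inl j) (inr (inr i)) = 0 /\ v (inr j) (inr (inr i)) = 0.
    move=> /mem_coord_seqP[j' js_j' Ei]; have [vx vy] := specW (inr (inr i)).
    have /negPf ne : j != j' by apply: contraNneq njs => ->.
    case: Ei => Ei; first by have [-> ->] := vx j' Ei j; rewrite ne !mul0r.
    by have [-> ->] := vy j' Ei j; rewrite ne !mul0r.
  rewrite !big_cons -(IHjs uniq_js) [koszul _ _ _](contraction_pair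
    (w := v (inl j)) (w' := v (inr j)) (koszul v (pair_seq js))); first last.
  - by move=> _ /mapP[i /zero[_ E] ->].
  - by move=> _ /mapP[i /zero[E _] ->].
  rewrite mulrACA; congr (_ * _).
  have [vx _] := specW (inr (inr (xi j))); have [-> ->] := vx j erefl j.
  have [_ vy] := specW (inr (inr (yi j))); have [-> ->] := vy j erefl j.
  rewrite eqxx !mul1r; apply: pair_weights; [exact: xa_neq0 | exact: yv_neq0 |].
  have -> : (z2%:MP)%:F - (z1%:MP)%:F = ((z2 - z1)%:MP)%:F :> Q by rewrite mpolyCB rmorphB.
  exact: mulVf z21_neq0.
pose letters := [seq inr (inr i) : letter | i <- coord_seq (enum 'I_m)].
have inv_diffE : inv_diff = ((z2 - z1)^-1%:MP)%:F.
  apply: (mulfI z21_neq0); rewrite divff ?z21_neq0 // -rmorphM -mpolyCM.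
  by rewrite divff ?subr_eq0 // mpolyC1 rmorph1.
have bE : coboundary b letters = koszul v r letters.
  by apply: db => _ /mapP[i _ ->]; apply: map_f; rewrite mem_enum.
have := eval _ (enum_uniq 'I_m); rewrite -/r -/letters -bE !big_enum /= xa_yvE.
rewrite prodr_const card_ord inv_diffE -!rmorphXn => Eb.
have e_gt0 i : (0 < [multinom match split i with inl j => a j | inr _ => 1%N end | i < m + m] i)%N.
  by rewrite mnmE; case: split.
have /eqP := coboundary_residue (h := letter_eq) (z := fun i => inr (inr i) : letter)
  (fun=> erefl) coord_seq_perm e_gt0 rb Eb.
by rewrite expf_eq0 invr_eq0 subr_eq0 (negPf z12) andbF.
Qed.

End GraphUnion.

(** * The toric variety *)

Section Toric.
Local Open Scope ring_scope.
Variables (K : closedFieldType) (n : nat) (hn : (2 <= n)%N) (d : nat) (a : 'I_n.-1 -> nat).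
Hypotheses (d_gt0 : (0 < d)%N) (a_gt0 : forall j, (0 < a j)%N).
Local Notation N := (2 * n - 1)%N.
Local Notation m := n.-1.

Definition x_index (i : 'I_n) : 'I_N := cast_ord (esym (ambient_dimE n)) (lshift m i).
Definition y_index (j : 'I_m) : 'I_N := cast_ord (esym (ambient_dimE n)) (rshift n j).
Local Notation last := (last_index hn).

Lemma split_x i : split (cast_ord (ambient_dimE n) (x_index i)) = inl i.
Proof. by rewrite cast_ordKV (unsplitK (inl _ i)). Qed.

Lemma split_y j : split (cast_ord (ambient_dimE n) (y_index j)) = inr j.
Proof. by rewrite cast_ordKV (unsplitK (inr _ j)). Qed.

Lemma index_ind (P : 'I_N -> Prop) :
  (forall i, P (x_index i)) -> (forall j, P (y_index j)) -> forall k, P k.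
Proof.
move=> Px Py k; rewrite -(cast_ordK (ambient_dimE n) k).
by case: (split_ordP (cast_ord (ambient_dimE n) k)) => i ->; [apply: Px | apply: Py].
Qed.

Lemma init_neq_last j : (init_index j == last) = false.
Proof. by rewrite -val_eqE /= ltn_eqF. Qed.

(** All parameters but the last one are coordinates of the point. *)
Lemma toric_varietyP v :
  toric_variety hn d a v <->
  exists t : K, t ^+ d = v 0 (x_index last) /\
    forall j, v 0 (y_index j) = v 0 (x_index (init_index j)) ^+ a j * t.
Proof.
split=> [[u ->]|[t [td ty]]].
  exists (u 0 last); split; first by rewrite mxE split_x eqxx.
  by move=> j; rewrite !mxE split_x split_y init_neq_last.
exists (\row_i if i == last then t else v 0 (x_index i)).
apply/rowP; elim/index_ind => [i|j]; rewrite mxE ?split_x ?split_y ?mxE.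
  by case: eqP => // ->.
by rewrite eqxx init_neq_last ty.
Qed.

Definition toric_equations : seq {mpoly K[N]} :=
  [seq 'X_(y_index j) ^+ d - 'X_(x_index (init_index j)) ^+ (a j * d) * 'X_(x_index last)
     | j <- enum 'I_m] ++
  [seq 'X_(y_index j) * 'X_(x_index (init_index k)) ^+ a k
       - 'X_(y_index k) * 'X_(x_index (init_index j)) ^+ a j
     | j <- enum 'I_m, k <- enum 'I_m].

Lemma root_exists (c : K) : exists t, t ^+ d = c.
Proof.
have [|t] := closed_rootP ('X^d - c%:P) _; first by rewrite size_XnsubC // eqSS -lt0n.
by rewrite /root !hornerE subr_eq0 => /eqP; exists t.
Qed.

(** If some [x_j] with [j < n] is nonzero, the last parameter is
    [y_j / x_j ^ a_j]; otherwise all [y_j] vanish and any [d]-th root of [x_n]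
    will do. *)
Lemma toric_equationsP (v : 'rV[K]_N) :
  toric_variety hn d a v <-> zero_at (v 0) toric_equations.
Proof.
rewrite toric_varietyP /zero_at all_cat; split.
  case=> t [td ty]; apply/andP; split; apply/allP.
    move=> _ /mapP[j _ ->].
    rewrite mevalB mevalM !rmorphXn /= !mevalXU ty exprMn td -exprM subrr //.
  move=> _ /allpairsP[[j k] /= [_ _ ->]].
  by rewrite mevalB !mevalM !rmorphXn /= !mevalXU !ty mulrAC [X in _ - X]mulrAC subr_eq0 [X in _ == X * _]mulrC.
case/andP=> /allP pow /allP minors.
have Epow j : v 0 (y_index j) ^+ d = v 0 (x_index (init_index j)) ^+ (a j * d) * v 0 (x_index last).
  have := pow _ (map_f _ (mem_enum 'I_m j)).
  by rewrite mevalB mevalM !rmorphXn /= !mevalXU subr_eq0 => /eqP.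
have Eminor j k : v 0 (y_index j) * v 0 (x_index (init_index k)) ^+ a k
    = v 0 (y_index k) * v 0 (x_index (init_index j)) ^+ a j.
  have := minors _ (allpairs_f _ (mem_enum 'I_m j) (mem_enum 'I_m k)).
  by rewrite mevalB !mevalM !rmorphXn /= !mevalXU subr_eq0 => /eqP.
case: (pickP (fun j => v 0 (x_index (init_index j)) != 0)) => [j nzj|all0].
  have nza : v 0 (x_index (init_index j)) ^+ a j != 0 by rewrite expf_neq0.
  exists (v 0 (y_index j) / v 0 (x_index (init_index j)) ^+ a j); split.
    by rewrite expr_div_n Epow exprM mulrAC divff ?mul1r // expf_neq0.
  by move=> k; rewrite mulrA [_ * v 0 (y_index j)]mulrC Eminor mulfK.
have [t td] := root_exists (v 0 (x_index last)); exists t; split=> // j.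
have /eqP x0 : v 0 (x_index (init_index j)) == 0 by have := all0 j; case: eqP.
rewrite x0 expr0n gtn_eqF // mul0r; apply/eqP.
have := Epow j; rewrite x0 expr0n gtn_eqF ?muln_gt0 ?a_gt0 // mul0r => /eqP.
by rewrite expf_eq0 => /andP[].
Qed.

Lemma defined_by_toric_equations :
  defined_by_equations (@toric_variety K n hn d a) (size toric_equations).
Proof.
exists (fun i => toric_equations`_i) => v; rewrite toric_equationsP.
split=> [zv i|zv]; first exact: zero_at_nth.
by apply/(all_nthP 0) => i lt_i; apply/eqP/(zv (Ordinal lt_i)).
Qed.

(** The embedding of [K^(2m)] as the hyperplane [x_n = 1]; [insub] fails at the
    last index. *)
Definition slice_coord (k : 'I_N) : {mpoly K[m + m]} :=
  match split (cast_ord (ambient_dimE n) k) with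
  | inl i => if insub (val i) is Some j then 'X_(lshift m j) else 1
  | inr j => 'X_(rshift m j)
  end.

Lemma slice_init j : slice_coord (x_index (init_index j)) = 'X_(lshift m j).
Proof. by rewrite /slice_coord split_x valK. Qed.

Lemma slice_last : slice_coord (x_index last) = 1.
Proof. by rewrite /slice_coord split_x insubF // ltnn. Qed.

Lemma slice_y j : slice_coord (y_index j) = 'X_(rshift m j).
Proof. by rewrite /slice_coord split_y. Qed.

Lemma unity_roots : {zs : seq K | forall z, (z \in zs) = (z ^+ d == 1)}.
Proof.
have [zs def_zs] := closed_field_poly_normal ('X^d - 1 : {poly K}); exists zs => z.
have lc0 : lead_coef ('X^d - 1 : {poly K}) != 0.
  by rewrite lead_coef_eq0 -size_poly_gt0 size_XnsubC.
rewrite -root_prod_XsubC -(rootZ _ _ lc0) -def_zs.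
by rewrite /root !hornerE subr_eq0.
Qed.

Lemma size_toric_equations s (z2 : K) : z2 ^+ d = 1 -> z2 != 1 ->
  defined_by_equations (@toric_variety K n hn d a) s -> (N - 2 <= s)%N.
Proof.
move=> z2d z21 [F FE]; have [zs zsE] := unity_roots.
pose Fs := [seq F i \mPo [tuple slice_coord k | k < N] | i <- enum 'I_s].
have FsE v : zero_at v Fs = has (fun z => zero_at v (graph a z)) zs.
  pose w : 'rV[K]_N := \row_k (slice_coord k).@[v].
  have Fw i : (F i \mPo [tuple slice_coord k | k < N]).@[v] = (F i).@[w 0].
    by rewrite comp_mpoly_meval; apply: meval_eq => k; rewrite tnth_mktuple mxE.
  have Vw : zero_at v Fs <-> toric_variety hn d a w.
    rewrite FE; split=> [/allP zF i|zF].
      by apply/eqP; rewrite -Fw; apply: zF; apply: map_f; rewrite mem_enum.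
    by apply/allP => _ /mapP[i _ ->]; rewrite Fw zF.
  rewrite toric_varietyP mxE slice_last meval1 in Vw.
  have wx j : w 0 (x_index (init_index j)) = v (lshift m j) by rewrite mxE slice_init mevalXU.
  have wy j : w 0 (y_index j) = v (rshift m j) by rewrite mxE slice_y mevalXU.
  apply/idP/idP => [/Vw[t [td ty]]|/hasP[z]].
    apply/hasP; exists t; first by rewrite zsE td.
    by apply/zero_at_graphP => j; rewrite -wx -wy ty mulrC.
  rewrite zsE => /eqP zd /zero_at_graphP gz; apply/Vw; exists z; split=> // j.
  by rewrite wx wy gz mulrC.
have m_gt0 : (0 < m)%N by rewrite -ltnS prednK // (leq_trans _ hn).
have := graph_union_size (zs := zs) (z1 := 1) (z2 := z2) m_gt0 a_gt0 _ _ z21 FsE.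
rewrite !zsE expr1n z2d eqxx size_map size_enum_ord => /(_ isT isT).
apply: leq_trans; case: (n) hn => // n' _.
by rewrite ambient_dimE /= addSn subSS subn1.
Qed.

End Toric.

Section RootsOfUnity.
Local Open Scope ring_scope.
Variable K : closedFieldType.

(** A root of [1 + X + ... + X^(p - 1)], whose value at 1 is [p]. *)
Lemma prime_unity_root p : prime p -> p%:R != 0 :> K -> exists2 z : K, z ^+ p = 1 & z != 1.
Proof.
move=> p_pr nzp; pose P : {poly K} := \sum_(i < p) 'X^i.
have sizeP : size P = p.
  have -> : P = \poly_(i < p) 1 by rewrite poly_def; apply: eq_bigr => i _; rewrite scale1r.
  by rewrite size_poly_eq ?oner_neq0.
have [|z] := closed_rootP P _; first by rewrite sizeP gtn_eqF ?prime_gt1.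
rewrite /root horner_sum => /eqP Pz; exists z.
  apply/eqP; rewrite -subr_eq0 subrX1; rewrite [X in _ * X](_ : _ = 0) ?mulr0 //.
  by rewrite -[RHS]Pz; apply: eq_bigr => i _; rewrite hornerXn.
apply: contraNneq nzp => z1; rewrite -Pz z1.
rewrite (eq_bigr (fun=> 1)) ?sumr_const ?card_ord // => i _.
by rewrite hornerXn expr1n.
Qed.

Lemma unity_root_neq1 d p q : prime p -> prime q -> p <> q -> (p %| d)%N -> (q %| d)%N ->
  exists2 z : K, z ^+ d = 1 & z != 1.
Proof.
move=> p_pr q_pr pq pd qd.
have lift r : prime r -> (r %| d)%N -> r%:R != 0 :> K -> exists2 z : K, z ^+ d = 1 & z != 1.
  move=> r_pr /dvdnP[k ->] /(prime_unity_root r_pr)[z zr nz1]; exists z => //.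
  by rewrite mulnC exprM zr expr1n.
have [p0|] := eqVneq (p%:R : K) 0; last exact: lift.
have [q0|] := eqVneq (q%:R : K) 0; last exact: lift.
have pP : p \in [pchar K] by rewrite inE p_pr p0 eqxx.
have qP : q \in [pchar K] by rewrite inE q_pr q0 eqxx.
by move: qP; rewrite (pcharf_eq pP) inE => /eqP qp; case: pq.
Qed.

End RootsOfUnity.

Lemma min_exists (P : nat -> Prop) s :
  P s -> exists r, P r /\ forall s', P s' -> (r <= s')%N.
Proof.
elim/ltn_ind: s => s IHs Ps.
have [[s' [lt_s' Ps']]|no] := classic (exists s', (s' < s)%N /\ P s'); first exact: IHs Ps'.
exists s; split=> // s' Ps'; rewrite leqNgt; apply/negP => lt_s'.
by apply: no; exists s'.
Qed.

Theorem theorem1 (K : closedFieldType) (n : nat) (hn : (2 <= n)%N)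
    (d : nat) (a : 'I_n.-1 -> nat)
    (hd : (0 < d)%N) (ha : forall j : 'I_n.-1, (0 < a j)%N)
    (p q : nat) (hp : prime p) (hq : prime q) (hpq : p <> q)
    (hpd : (p %| d)%N) (hqd : (q %| d)%N) :
  let N := (2 * n - 1)%N in
  exists r : nat,
    is_arithmetical_rank (@toric_variety K n hn d a) r /\ (N - 2 <= r)%N.
Proof.
have [r [Vr rmin]] := min_exists (defined_by_toric_equations K hn hd ha).
have [z zd z1] := unity_root_neq1 K hp hq hpq hpd hqd.
by exists r; split=> //; apply: size_toric_equations zd z1 Vr.
Qed.
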